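(* If $p\colon\mathbb{N}\to(0,1)$ satisfies $(1-p(n))n^2\to\infty$ as $n\to\infty$ and $p(n)\ge 5\sqrt{\frac{\log n}{n}}$ for all sufficiently large $n$, then asymptotically almost surely $\Gamma\in\mathcal{G}(n,p)$ lies in $\mathcal{CFS}$.
   Context: Graphs are finite and simple. $\mathcal{G}(n,p)$ is the random graph on $n$ labelled vertices in which each of the $\binom n2$ possible edges is included independently with probability $p=p(n)$. A property holds asymptotically almost surely if its probability tends to $1$ as $n\to\infty$. ''Subgraph'' means induced subgraph. A clique is a complete graph on $t\ge 0$ vertices (the empty graph is a clique). The join $A\star B$ is obtained from $A\sqcup B$ by joining every vertex of $A$ to every vertex of $B$. The square-graph $\square(\Gamma)$ of a graph $\Gamma$ is the graph whose vertices are the induced $4$-cycles of $\Gamma$, with two distinct $4$-cycles joined by an edge if and only if they share a diagonal, i.e. their vertex sets have in common a pair of vertices that are non-adjacent in $\Gamma$ (they may have a third vertex in common). A graph $\Gamma$ belongs to $\mathcal{CFS}$ if $\Gamma=\Gamma'\star K$, where $K$ is a (possibly empty) clique and $\Gamma'$ is a non-empty subgraph such that $\square(\Gamma')$ has a connected component $C$ for which the union of the $4$-cycles in $C$ covers all of $V(\Gamma')$. *)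

(* Defs.v *)
From HB Require Import structures.
From mathcomp Require Import all_boot all_order all_algebra.

Set Implicit Arguments.
Unset Strict Implicit.
Unset Printing Implicit Defensive.

Import GRing.Theory.

Record graph (T : finType) := Graph {
  adj :> rel T;
  adj_sym : symmetric adj;
  adj_irr : irreflexive adj
}.

Section InducedSubgraph.
Variables (T : finType) (G : graph T) (A : {set T}).

Definition induced_adj : rel {x : T | x \in A} := fun x y => adj G (val x) (val y).

Lemma induced_adj_sym : symmetric induced_adj.
Proof. by move=> x y; apply: adj_sym. Qed.

Lemma induced_adj_irr : irreflexive induced_adj.
Proof. by move=> x; apply: adj_irr. Qed.

Definition induced : graph {x : T | x \in A} := Graph induced_adj_sym induced_adj_irr.
End InducedSubgraph.

Section SquareGraph.
Variables (T : finType) (G : graph T).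

(* An induced 4-cycle is determined by its vertex set. *)
Definition induced_C4 (S : {set T}) : bool :=
  [exists a, exists b, exists c, exists d,
    [&& S == [set a; b; c; d], uniq [:: a; b; c; d],
        adj G a b, adj G b c, adj G c d, adj G d a,
        ~~ adj G a c & ~~ adj G b d]].

Definition C4 : finType := {S : {set T} | induced_C4 S}.

Definition share_diagonal (S S' : {set T}) : bool :=
  [exists x in S :&: S', exists y in S :&: S', (x != y) && ~~ adj G x y].

Definition square_adj : rel C4 :=
  fun S S' => (S != S') && share_diagonal (val S) (val S').

Lemma square_adj_sym : symmetric square_adj.
Proof. by move=> S S'; rewrite /square_adj eq_sym /share_diagonal setIC. Qed.

Lemma square_adj_irr : irreflexive square_adj.
Proof. by move=> S; rewrite /square_adj eqxx. Qed.

Definition square_graph : graph C4 := Graph square_adj_sym square_adj_irr.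
End SquareGraph.

Section CFS.
Variables (T : finType) (G : graph T).

Definition connected_component (C : {set T}) : bool :=
  [exists x, C == [set y | connect (adj G) x y]].

Definition clique (K : {set T}) : bool :=
  [forall x in K, forall y in K, (x != y) ==> adj G x y].

(* G is the join of its subgraphs induced on A and B. *)
Definition is_join (A B : {set T}) : bool :=
  [&& A :|: B == [set: T], [disjoint A & B] &
      [forall x in A, forall y in B, adj G x y]].
End CFS.

Definition full_support_component (T : finType) (G : graph T) : bool :=
  [exists C : {set C4 G},
    connected_component (square_graph G) C &&
    (\bigcup_(S in C) val S == [set: T])].

Definition CFS (T : finType) (G : graph T) : bool :=
  [exists A : {set T}, exists K : {set T},
    [&& is_join G A K, clique G K, A != set0 &
        full_support_component (induced G A)]].

Section RandomGraph.
Variable n : nat.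

Definition possible_edge : finType := {e : {set 'I_n} | #|e| == 2}.

Definition edges_adj (E : {set possible_edge}) : rel 'I_n :=
  fun x y => [exists e in E, val e == [set x; y]].

Lemma edges_adj_sym E : symmetric (edges_adj E).
Proof. by move=> x y; rewrite /edges_adj setUC. Qed.

Lemma edges_adj_irr E : irreflexive (edges_adj E).
Proof.
move=> x; apply/negbTE/negP => /existsP[e /andP[_ /eqP ex]].
by have := valP e; rewrite ex setUid cards1.
Qed.

Definition graph_of_edges (E : {set possible_edge}) : graph 'I_n :=
  Graph (edges_adj_sym E) (edges_adj_irr E).

Local Open Scope ring_scope.

(* The product of independent Bernoulli(p) laws, one for each possible edge. *)
Definition Gnp_mass (R : numDomainType) (p : R) (E : {set possible_edge}) : R :=
  \prod_(e : possible_edge) (if e \in E then p else 1 - p).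

Definition Gnp_prob (R : numDomainType) (p : R) (Q : pred (graph 'I_n)) : R :=
  \sum_(E : {set possible_edge} | Q (graph_of_edges E)) Gnp_mass p E.
End RandomGraph.

(* Main.v *)
Require Import Defs.
From mathcomp Require Import all_boot all_order all_algebra.
From mathcomp Require Import ring lra zify.

(* Two non-edges are linked when all four edges between them are present, so that they are the
   diagonals of an induced 4-cycle. Two such 4-cycles sharing a diagonal correspond to two links
   with a common end, so a graph is in CFS as soon as one connected component of the link relation
   has an edge and covers every vertex that is not adjacent to all the others. Write q = 1 - p.

   Dense case, n p^8 >= 1. For non-edges e and f, the common neighbourhood of their at most four
   ends has at least k = n p^4 / 4 elements up to exponentially small probability, hence is a clique
   with probability at most p^C(k,2); otherwise it contains a non-edge linked to both e and f.
   The expected number of pairs (e, f) is at most n^2 q + (n^2 q)^2, and n^2 q tends to infinity.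

   Sparse case, n p^8 <= 1. There is no clique on 18 vertices. Split the vertices into two halves,
   and in each half grow greedily a sequence of disjoint non-edges, each linked to an earlier one.
   If such a sequence of length k <= n/8 cannot be extended, then each of its k pairs has at most 17
   common neighbours among at least n/4 unused vertices; as n p^2 >= 25 log n this is too unlikely
   to happen for any of the n^(2k) sequences. The edges between the two halves are independent of
   these sequences. A vertex of the other half that sees both ends of some but not of all pairs of
   a sequence sees both ends of one member and misses an end of another one linked to it, hence
   forms with that end a non-edge linked to the sequence; and some pair of the first sequence is
   linked to one of the second, as there are about n^2 candidates, each of probability p^4. *)

Set Implicit Arguments.
Unset Strict Implicit.
Unset Printing Implicit Defensive.

Import Order.TTheory GRing.Theory Num.Theory.

(** * Random subsets of a finite set *)

Section ProductMeasure.
Variables (R : realFieldType) (I : finType) (p : R).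
Implicit Types (E F B : {set I}) (f g : {set I} -> R).
Local Open Scope ring_scope.

Definition mass E : R := \prod_i (if i \in E then p else 1 - p).

Definition Ex f : R := \sum_E mass E * f E.

Definition Pr (Q : pred {set I}) : R := Ex (fun E => (Q E)%:R).

(** Conditioning on the coordinates in [F] amounts to fixing [E1] and averaging over an independent
    [E2]. *)
Definition mix F E1 E2 : {set I} := E1 :&: F :|: E2 :\: F.

Lemma PrE Q : Pr Q = \sum_(E | Q E) mass E.
Proof.
by rewrite /Pr /Ex [RHS]big_mkcond; apply: eq_bigr => E _; case: (Q E); rewrite ?mulr1 ?mulr0.
Qed.

Lemma eq_Ex f g : f =1 g -> Ex f = Ex g.
Proof. by move=> fg; apply: eq_bigr => E _; rewrite fg. Qed.

(** Expanding a product of two-term sums yields one term for each subset of [I]. *)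
Lemma Ex_prod (phi : I -> bool -> R) :
  Ex (fun E => \prod_i phi i (i \in E)) = \prod_i (p * phi i true + (1 - p) * phi i false).
Proof.
rewrite bigA_distr; apply: eq_bigr => E _.
by rewrite -big_split; apply: eq_bigr => i _; case: (i \in E).
Qed.

Lemma ExD f g : Ex (fun E => f E + g E) = Ex f + Ex g.
Proof. by rewrite -big_split; apply: eq_bigr => E _; rewrite mulrDr. Qed.

Lemma ExZ c f : Ex (fun E => c * f E) = c * Ex f.
Proof. by rewrite mulr_sumr; apply: eq_bigr => E _; rewrite mulrCA. Qed.

Lemma Ex_sum (J : Type) (r : seq J) (P : pred J) (F : J -> {set I} -> R) :
  Ex (fun E => \sum_(j <- r | P j) F j E) = \sum_(j <- r | P j) Ex (F j).
Proof. by rewrite exchange_big; apply: eq_bigr => E _; rewrite mulr_sumr. Qed.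

Lemma Ex1 : Ex (fun=> 1) = 1.
Proof.
transitivity (Ex (fun E => \prod_i (fun (_ : I) (_ : bool) => 1) i (i \in E))).
  by apply: eq_Ex => E; rewrite big1.
by rewrite (Ex_prod (fun _ _ => 1)) big1 // => i _; rewrite !mulr1 addrCA subrr addr0.
Qed.

Lemma sum_mass : \sum_E mass E = 1.
Proof. by rewrite -Ex1; apply: eq_bigr => E _; rewrite mulr1. Qed.

Lemma Ex_cst c : Ex (fun=> c) = c.
Proof.
rewrite -[RHS]mulr1 -Ex1 -ExZ; apply: eq_Ex => E; by rewrite mulr1.
Qed.

Lemma Pr_compl (Q : pred {set I}) : Pr Q = 1 - Pr (fun E => ~~ Q E).
Proof.
apply/eqP; rewrite eq_sym subr_eq /Pr -ExD -[X in X == _]Ex1; apply/eqP; apply: eq_Ex => E.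
by case: (Q E); rewrite ?addr0 ?add0r.
Qed.

Lemma mass_mix F E1 E2 : mass (mix F E1 E2) * mass (mix F E2 E1) = mass E1 * mass E2.
Proof.
rewrite /mass -!big_split; apply: eq_bigr => i _; rewrite !inE.
by case: (i \in F); rewrite ?andbT ?andbF ?orbF //= mulrC.
Qed.

(* Swapping the coordinates in F between two independent copies of the random set is an involution
   that preserves their joint law. *)
Lemma Ex_mix F f : Ex f = Ex (fun E1 => Ex (fun E2 => f (mix F E1 E2))).
Proof.
transitivity (\sum_(E : {set I} * {set I}) mass E.1 * mass E.2 * f E.1).
  rewrite -(pair_bigA _ (fun E1 E2 => mass E1 * mass E2 * f E1)) /=; apply: eq_bigr => E _.
  by under eq_bigr => E2 _ do rewrite mulrAC; rewrite -mulr_sumr sum_mass mulr1.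
pose sw (E : {set I} * {set I}) := (mix F E.1 E.2, mix F E.2 E.1).
have swK : involutive sw.
  move=> [E1 E2]; congr pair; apply/setP => i; rewrite !inE /=;
  by case: (i \in F); case: (i \in E1); case: (i \in E2).
rewrite (reindex_inj (inv_inj swK)) /=.
rewrite -(pair_bigA _ (fun E1 E2 => mass (mix F E1 E2) * mass (mix F E2 E1) * f (mix F E1 E2))) /=.
apply: eq_bigr => E1 _; rewrite mulr_sumr; apply: eq_bigr => E2 _.
by rewrite mass_mix mulrA.
Qed.

Lemma mix_subl F B E1 E2 : B \subset F -> (B \subset mix F E1 E2) = (B \subset E1).
Proof.
move=> /subsetP BF; apply/subsetP/subsetP => H i Bi; have := H i Bi;
by rewrite !inE BF // andbT orbF.
Qed.

Lemma mix_subr F B E1 E2 : [disjoint B & F] -> (B \subset mix F E1 E2) = (B \subset E2).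
Proof.
move=> BF; apply/subsetP/subsetP => H i Bi; have := H i Bi;
by rewrite !inE (disjointFr BF Bi) ?andbF //= => ->.
Qed.

Lemma mix_disjl F B E1 E2 : B \subset F -> [disjoint B & mix F E1 E2] = [disjoint B & E1].
Proof.
move=> /subsetP BF; rewrite -!setI_eq0; congr (_ == _); apply/setP => i; rewrite !inE.
by case: (boolP (i \in B)) => //= /BF ->; rewrite andbT orbF.
Qed.

(** The hypotheses express that [f] depends only on the coordinates in [F] and [g] only on the
    others, so [Ex_mix] separates the two factors. *)
Lemma Ex_indep F (f g : {set I} -> R) :
    (forall E1 E2, f (mix F E1 E2) = f E1) -> (forall E1 E2, g (mix F E1 E2) = g E2) ->
  Ex (fun E => f E * g E) = Ex f * Ex g.
Proof.
move=> hf hg; rewrite (Ex_mix F) mulrC -ExZ; apply: eq_Ex => E1.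
by rewrite mulrC -ExZ; apply: eq_Ex => E2; rewrite hf hg.
Qed.

Lemma Pr_sub B : Pr (fun E => B \subset E) = p ^+ #|B|.
Proof.
pose phi i (b : bool) : R := ((i \in B) ==> b)%:R.
rewrite /Pr (_ : Ex _ = Ex (fun E => \prod_i phi i (i \in E))); last first.
  apply: eq_Ex => E; have [BE|] := boolP (B \subset E).
    by rewrite big1 // => i _; rewrite /phi; case: (boolP (i \in B)) => // /(subsetP BE) ->.
  case/subsetPn => i Bi Ei; rewrite (bigD1 i) //= /phi Bi (negbTE Ei) /=.
  by rewrite mul0r.
rewrite Ex_prod (bigID (mem B)) /= [X in _ * X]big1 ?mulr1; last first.
  by move=> i /negbTE Bi; rewrite /phi Bi /= !mulr1 addrCA subrr addr0.
rewrite -prodr_const; apply: eq_bigr => i Bi; rewrite /phi Bi /= mulr1 mulr0 addr0 //.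
Qed.

Lemma Pr_disjoint B : Pr (fun E => [disjoint B & E]) = (1 - p) ^+ #|B|.
Proof.
pose phi i (b : bool) : R := ((i \in B) ==> ~~ b)%:R.
rewrite /Pr (_ : Ex _ = Ex (fun E => \prod_i phi i (i \in E))); last first.
  apply: eq_Ex => E; have [BE|] := boolP [disjoint B & E].
    by rewrite big1 // => i _; rewrite /phi; case: (boolP (i \in B)) => // /(disjointFr BE) ->.
  rewrite -setI_eq0 => /set0Pn[i]; rewrite inE => /andP[Bi Ei].
  by rewrite (bigD1 i) //= /phi Bi Ei mul0r.
rewrite Ex_prod (bigID (mem B)) /= [X in _ * X]big1 ?mulr1; last first.
  by move=> i /negbTE Bi; rewrite /phi Bi /= !mulr1 addrCA subrr addr0.
rewrite -prodr_const; apply: eq_bigr => i Bi; rewrite /phi Bi /= mulr1 mulr0 add0r //.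
Qed.

(** Disjoint blocks are independent and can be split off one at a time. The integrand is [l] to the
    power of the number of blocks contained in [E]; for [l] = 0 it is the indicator that there is
    none. *)
Lemma Ex_blocks (J : eqType) (r : seq J) (B : J -> {set I}) (l : R) :
    uniq r -> {in r &, forall i j, i != j -> [disjoint B i & B j]} ->
  Ex (fun E => \prod_(j <- r) (if B j \subset E then l else 1))
    = \prod_(j <- r) (1 - (1 - l) * p ^+ #|B j|).
Proof.
elim: r => [_ _|j r IH /= /andP[jr ur] dis].
  rewrite big_nil -[RHS]Ex1; apply: eq_Ex => E; by rewrite big_nil.
under eq_Ex => E do rewrite big_cons.
rewrite big_cons (@Ex_indep (B j)) ?IH //; first 1 last.
- by move=> i k ir kr; apply: dis; rewrite inE ?ir ?kr orbT.
- by move=> E1 E2; rewrite mix_subl.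
- move=> E1 E2; rewrite big_seq [RHS]big_seq; apply: eq_bigr => i ir.
  rewrite mix_subr // dis ?inE ?ir ?eqxx ?orbT //.
  by apply: contraNneq jr => <-.
congr (_ * _); transitivity (Ex (fun E => 1 + - (1 - l) * (B j \subset E)%:R)).
  by apply: eq_Ex => E; case: (B j \subset E) => /=; ring.
by rewrite ExD Ex1 ExZ [X in _ * X]Pr_sub mulNr.
Qed.

(** * Monotonicity, union bounds and tail bounds for disjoint blocks *)

Section Ordered.
Hypothesis p01 : 0 <= p <= 1.

Lemma mass_ge0 E : 0 <= mass E.
Proof. by apply: prodr_ge0 => i _; case: ifP => _ //; rewrite ?subr_ge0; case/andP: p01. Qed.

Lemma le_Ex f g : (forall E, f E <= g E) -> Ex f <= Ex g.
Proof. by move=> fg; apply: ler_sum => E _; rewrite ler_wpM2l ?mass_ge0. Qed.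

Lemma Ex_ge0 f : (forall E, 0 <= f E) -> 0 <= Ex f.
Proof. by move=> f0; rewrite -(Ex_cst 0); apply: le_Ex. Qed.

Lemma le_Pr (P Q : pred {set I}) : (forall E, P E -> Q E) -> Pr P <= Pr Q.
Proof.
by move=> PQ; apply: le_Ex => E; case: (boolP (P E)) => [/PQ -> //|_]; case: (Q E).
Qed.

Lemma Pr_le1 (P : pred {set I}) : Pr P <= 1.
Proof. by rewrite -Ex1; apply: le_Ex => E; case: (P E). Qed.

Lemma Pr_ge0 (P : pred {set I}) : 0 <= Pr P.
Proof. by apply: Ex_ge0 => E; rewrite ler0n. Qed.

Lemma Pr_or (P Q : pred {set I}) : Pr (fun E => P E || Q E) <= Pr P + Pr Q.
Proof. by rewrite -ExD; apply: le_Ex => E; case: (P E); case: (Q E) => //=; lra. Qed.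

Lemma Pr_exists (J : finType) (D : pred J) (Q : J -> pred {set I}) :
  Pr (fun E => [exists j, D j && Q j E]) <= \sum_(j | D j) Pr (Q j).
Proof.
rewrite -Ex_sum; apply: le_Ex => E; case: existsP => [[j /andP[Dj Qj]]|_].
  rewrite (bigD1 j) //= Qj lerDl; apply: sumr_ge0 => i _; exact: ler0n.
by apply: sumr_ge0 => i _; exact: ler0n.
Qed.

Lemma le_Ex_blocks (J : eqType) (r : seq J) (B : J -> {set I}) (l : R) b :
    0 <= l <= 1 -> uniq r -> {in r &, forall i j, i != j -> [disjoint B i & B j]} ->
    {in r, forall j, #|B j| <= b}%N ->
  Ex (fun E => \prod_(j <- r) (if B j \subset E then l else 1)) <= (1 - (1 - l) * p ^+ b) ^+ size r.
Proof.
move=> /andP[l0 l1] ur dis cB; have /andP[p0 p1] := p01; rewrite Ex_blocks //.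
elim: r cB {ur dis} => [|j r IH] cB; first by rewrite big_nil.
have pl k : 0 <= (1 - l) * p ^+ k <= 1.
  by rewrite mulr_ge0 ?subr_ge0 ?exprn_ge0 //= mulr_ile1 ?subr_ge0 ?exprn_ge0 ?exprn_ile1 // lerBlDr lerDl.
rewrite big_cons exprS ler_pM //.
- by rewrite subr_ge0; case/andP: (pl #|B j|).
- by apply: prodr_ge0 => i _; rewrite subr_ge0; case/andP: (pl #|B i|).
- rewrite lerD2l lerN2 ler_wpM2l ?subr_ge0 // ler_wiXn2l // cB ?inE ?eqxx //.
- by apply: IH => i ir; rewrite cB // inE ir orbT.
Qed.

Lemma Pr_no_block (J : eqType) (r : seq J) (B : J -> {set I}) b :
    uniq r -> {in r &, forall i j, i != j -> [disjoint B i & B j]} ->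
    {in r, forall j, #|B j| <= b}%N ->
  Pr (fun E => all (fun j => ~~ (B j \subset E)) r) <= (1 - p ^+ b) ^+ size r.
Proof.
(* This is the case [l] = 0 of [le_Ex_blocks]. *)
move=> ur dis cB; rewrite -[p ^+ b]mul1r -[X in X * _]subr0.
apply: le_trans (le_Ex_blocks _ ur dis cB); last by rewrite lexx ler01.
apply: le_Ex => E; case: (boolP (all _ _)) => [/allP H|_].
  by rewrite big_seq big1 // => j /H /negbTE ->.
by apply: prodr_ge0 => j _; case: ifP; rewrite ?ler01 ?lexx.
Qed.

(* Markov's inequality applied to l to the power of the number of blocks contained in E. *)
Lemma Pr_few_blocks (J : eqType) (r : seq J) (B : J -> {set I}) (l : R) b t :
    0 < l <= 1 -> uniq r -> {in r &, forall i j, i != j -> [disjoint B i & B j]} ->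
    {in r, forall j, #|B j| <= b}%N ->
  Pr (fun E => count (fun j => B j \subset E) r <= t)%N
    <= l^-1 ^+ t * (1 - (1 - l) * p ^+ b) ^+ size r.
Proof.
move=> /andP[l0 l1] ur dis cB.
have l01 : 0 <= l <= 1 by rewrite ltW.
apply: le_trans (ler_wpM2l _ (le_Ex_blocks l01 ur dis cB)); last by rewrite exprn_ge0 ?invr_ge0 ?ltW.
rewrite -ExZ; apply: le_Ex => E.
have -> : \prod_(j <- r) (if B j \subset E then l else 1) = l ^+ count (fun j => B j \subset E) r.
  elim: r {ur dis cB} => [|j r IH]; first by rewrite big_nil.
  by rewrite big_cons IH /=; case: ifP; rewrite ?exprS ?mul1r.
case: leqP => [ct|_] /=; last by rewrite mulr_ge0 ?exprn_ge0 ?invr_ge0 ?ltW.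
rewrite exprVn mulrC ler_pdivlMr ?exprn_gt0 // mul1r.
by rewrite ler_wiXn2l // ltW.
Qed.

End Ordered.
End ProductMeasure.

(** * Links between non-edges *)

(** Induction along a path; [P] takes values in [Prop] so that it can quantify over proofs of
    links. *)
Lemma connect_inv (T : finType) (r : rel T) (P : T -> Prop) x y :
  connect r x y -> P x -> (forall a b, r a b -> P a -> P b) -> P y.
Proof.
move=> /connectP[s]; elim: s x => [|z s IH] x /=; first by move=> _ ->.
by move=> /andP[xz zs] yl Px step; apply: (IH z) => //; apply: step Px.
Qed.

Section Link.
Variables (T : finType) (G : graph T).
Implicit Types e f : T * T.

(** Pairs are ordered so that a vertex to be covered can be named as the first coordinate. *)
Definition nonedge e := (e.1 != e.2) && ~~ adj G e.1 e.2.

Definition link : rel (T * T) := fun e f =>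
  [&& nonedge e, nonedge f, adj G e.1 f.1, adj G e.1 f.2, adj G e.2 f.1 & adj G e.2 f.2].

Definition ends e : {set T} := [set e.1; e.2].

Lemma adj_neq x y : adj G x y -> x != y.
Proof. by move=> xy; apply/eqP => yx; rewrite yx adj_irr in xy. Qed.

Lemma link_sym : symmetric link.
Proof.
move=> e f; rewrite /link (adj_sym G f.1) (adj_sym G f.1 e.2) (adj_sym G f.2) (adj_sym G f.2 e.2).
by apply/and5P/and5P => -[? ? ? ? /andP[? ?]]; split => //; apply/andP.
Qed.

Lemma link_nonedgel e f : link e f -> nonedge e.
Proof. by case/and3P. Qed.

Lemma link_nonedger e f : link e f -> nonedge f.
Proof. by case/and3P. Qed.

Lemma link_C4 e f : link e f -> induced_C4 G (ends e :|: ends f).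
Proof.
case: e f => [a c] [b d] /and5P[/= /andP[/= ac nac] /andP[/= bd nbd] ab ad /andP[cb cd]].
apply/existsP; exists a; apply/existsP; exists b; apply/existsP; exists c; apply/existsP; exists d.
apply/and5P; split=> //.
- by apply/eqP/setP => x; rewrite !inE /=; case: (x == a); case: (x == b); case: (x == c); case: (x == d).
- rewrite /= !inE !negb_or (adj_neq ab) ac (adj_neq ad) bd (adj_neq cd) eq_sym (adj_neq cb) //.
- by rewrite adj_sym.
- by rewrite cd adj_sym ad nac.
Qed.

Definition square_of e f (h : link e f) : C4 G := Sub (ends e :|: ends f) (link_C4 h).

(** Both squares have the diagonal [e], so they are equal or adjacent. *)
Lemma square_connect e f f' (h : link e f) (h' : link e f') :
  connect (square_graph G) (square_of h) (square_of h').
Proof.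
have [->|hh'] := eqVneq (square_of h) (square_of h'); first exact: connect0.
apply: connect1; rewrite /= /square_adj hh' /=.
have /andP[e12 ne] := link_nonedgel h.
apply/existsP; exists e.1; rewrite !inE !eqxx /=.
by apply/existsP; exists e.2; rewrite !inE !eqxx ?orbT /= e12.
Qed.

Lemma square_ofC e f (h : link e f) (h' : link f e) : square_of h = square_of h'.
Proof. by apply: val_inj; rewrite /= setUC. Qed.

(** Consecutive links on a walk share a pair, so their squares share a diagonal: all links at pairs
    reachable from [e0] have their squares in one component. *)
Lemma full_support_of_link e0 f0 :
    link e0 f0 -> (forall v, exists w, connect link e0 (v, w)) ->
  full_support_component G.
Proof.
move=> h0 cov.
have reach e : connect link e0 e -> forall f (h : link e f),
    connect (square_graph G) (square_of h0) (square_of h).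
  move=> e0e.
  apply: (connect_inv (P := fun e => forall f (h : link e f), _) e0e) => [f h|a b ab Pa f h].
    exact: square_connect.
  have ba : link b a by rewrite link_sym.
  by apply: connect_trans (Pa _ ab) _; rewrite (square_ofC ab ba); apply: square_connect.
apply/existsP; exists [set S | connect (square_graph G) (square_of h0) S].
apply/andP; split; first by apply/existsP; exists (square_of h0).
apply/eqP/setP => v; rewrite [RHS]inE; apply/bigcupP.
have [w e0v] := cov v.
(* A reached pair is linked to its predecessor on the path, or to [f0] if it is [e0] itself. *)
have [f h] : exists f, link (v, w) f.
  apply: (connect_inv (P := fun e => exists f, link e f) e0v); first by exists f0.
  by move=> a b ab _; exists a; rewrite link_sym.
by exists (square_of h); rewrite ?inE ?eqxx // reach.
Qed.

End Link.

(** The vertices outside [A] are adjacent to all others and form the clique factor. All links live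
    inside [A], so link paths lift to the graph induced on [A]. *)
Lemma CFS_of_link (T : finType) (G : graph T) e0 f0 :
    link G e0 f0 ->
    (forall v u, nonedge G (v, u) -> exists w, connect (link G) e0 (v, w)) ->
  CFS G.
Proof.
move=> h0 cov; pose A := [set v | [exists u, nonedge G (v, u)]].
have univ x y : y \notin A -> x != y -> adj G x y.
  rewrite inE negb_exists => /forallP/(_ x); rewrite /nonedge /= negb_and negbK eq_sym.
  by move=> /orP[-> //|]; rewrite negbK adj_sym.
have inA x y : nonedge G (x, y) -> x \in A /\ y \in A.
  move=> xy; rewrite !inE; split; apply/existsP; first by exists y.
  by exists x; rewrite /nonedge /= eq_sym adj_sym; exact: xy.
have pA e : nonedge G e -> exists e' : {x | x \in A} * {x | x \in A}, (val e'.1, val e'.2) = e.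
  by case: e => x y /inA[xA yA]; exists (Sub x xA, Sub y yA).
have [e0' E0] := pA _ (link_nonedgel h0); have [f0' F0] := pA _ (link_nonedger h0).
apply/existsP; exists A; apply/existsP; exists (~: A); apply/and4P; split.
- rewrite /is_join setUCr eqxx -setI_eq0 setICr eqxx /=.
  apply/forall_inP => x xA; apply/forall_inP => y; rewrite inE => yA; apply: univ => //.
  by apply: contraNneq yA => <-.
- apply/forall_inP => x xA; apply/forall_inP => y; rewrite inE => yA; apply/implyP; exact: univ.
- by apply/set0Pn; exists (val e0'.1); exact: (valP e0'.1).
apply: (@full_support_of_link _ _ e0' f0'); first by rewrite -E0 -F0 in h0.
move=> [v vA]; have := vA; rewrite {1}inE => /existsP[u /cov[w e0v]].
have [e' [He' ce']] : exists e', (val e'.1, val e'.2) = (v, w) /\ connect (link (induced G A)) e0' e'.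
  apply: (connect_inv (P := fun e => exists e' : {x | x \in A} * {x | x \in A},
    (val e'.1, val e'.2) = e /\ connect (link (induced G A)) e0' e') e0v).
    by exists e0'; split => //; exact: connect0.
  move=> a b ab [a' [Ea ca']]; have [b' Eb] := pA _ (link_nonedger ab).
  exists b'; split => //; apply: connect_trans ca' (connect1 _).
  by rewrite -Ea -Eb in ab.
exists e'.2; case: e' He' ce' => -[x xA] y /= [xv _]; subst x.
by rewrite (bool_irrelevance xA vA).
Qed.

(** Any two non-edges are two links apart; the case of equal non-edges supplies the initial link. *)
Lemma CFS_of_common_links (T : finType) (G : graph T) :
    (exists e, nonedge G e) ->
    (forall e f, nonedge G e -> nonedge G f -> exists g, link G e g && link G g f) ->
  CFS G.
Proof.
move=> [e0 n0] H; have [f0 /andP[h0 _]] := H _ _ n0 n0.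
apply: (CFS_of_link h0) => v u vu; exists u; have [g /andP[eg gv]] := H _ _ n0 vu.
exact: connect_trans (connect1 eg) (connect1 gv).
Qed.

(** * Chains of disjoint linked non-edges *)

Section Chain.
Variables (T : finType) (G : graph T).
Implicit Types (A : {set T}) (e f : T * T) (s : seq (T * T)).

Definition verts s : {set T} := [set x | has (fun e => x \in ends e) s].

(* Chains list the most recent pair first: each pair is linked to an earlier one. *)
Fixpoint chain A s : bool :=
  if s is e :: s' then
    [&& nonedge G e, ends e \subset A, [disjoint ends e & verts s'],
        nilp s' || has (link G e) s' & chain A s']
  else true.

Definition sees v e := adj G v e.1 && adj G v e.2.

Lemma verts_cons e s : verts (e :: s) = ends e :|: verts s.
Proof. by apply/setP => x; rewrite in_setU ![x \in verts _]in_set. Qed.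

Lemma card_verts s : #|verts s| <= 2 * size s.
Proof.
elim: s => [|e s IH].
  by rewrite leqn0 cards_eq0; apply/eqP/setP => x; rewrite !inE.
rewrite verts_cons mulnS (leq_trans (leq_card_setU _ _)) // leq_add //.
by rewrite cards2 ltnS leq_b1.
Qed.

Lemma chain_sub A s : chain A s -> verts s \subset A.
Proof.
elim: s => [_|e s IH]; first by apply/subsetP => x; rewrite inE.
by case/and5P => _ eA _ _ /IH sA; rewrite verts_cons subUset eA.
Qed.

Lemma chain_nonedge A s e : chain A s -> e \in s -> nonedge G e.
Proof.
elim: s => // f s IH /and5P[nf _ _ _ cs]; rewrite inE => /orP[/eqP-> //|].
exact: IH.
Qed.

Lemma chain_connect A s : chain A s -> {in s &, forall e f, connect (link G) e f}.
Proof.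
have sym := sym_connect_sym (@link_sym T G).
elim: s => // e0 s IH /and5P[_ _ _ h /IH{}IH].
have hd f : f \in s -> connect (link G) e0 f.
  move=> fs; case/orP: h => [/nilP sn|/hasP[g gs eg]]; first by rewrite sn in fs.
  exact: connect_trans (connect1 eg) (IH _ _ gs fs).
move=> e f; rewrite !inE => /orP[/eqP->|es] /orP[/eqP->|fs]; rewrite ?connect0 ?hd //.
  by rewrite sym hd.
exact: IH.
Qed.

(** The links to earlier members form a spanning tree of the chain, so a property that is not
    constant on the chain changes across some link. *)
Lemma chain_cut A s (P : pred (T * T)) : chain A s -> has P s -> ~~ all P s ->
  exists e f, [/\ e \in s, f \in s, link G e f, P e & ~~ P f].
Proof.
elim: s => // e0 s IH /and5P[_ _ _ h cs].
have mem e : e \in s -> e \in e0 :: s by rewrite inE => ->; rewrite orbT.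
have [aP|naP] := boolP (all P s); have [hP|nhP] := boolP (has P s) => /= h1 h2.
- case/orP: h => [/nilP sn|/hasP[g gs eg]]; first by rewrite sn in hP.
  exists g, e0; rewrite link_sym eg mem_head (mem g) //; split => //; first exact: (allP aP).
  by move: h2; rewrite aP andbT.
- have sn : s = [::] by case: (s) aP nhP => //= a l /andP[->].
  by move: h1 h2; rewrite sn /= orbF andbT => ->.
- have [e [f [es fs ef Pe Pf]]] := IH cs hP naP.
  by exists e, f; split; rewrite ?mem.
- case/orP: h => [/nilP sn|/hasP[g gs eg]]; first by rewrite sn in naP.
  exists e0, g; split; rewrite ?mem_head ?(mem g) //; first by move: h1; rewrite (negbTE nhP) orbF.
  by apply: contra nhP => Pg; apply/hasP; exists g.
Qed.

(** [chain_cut] for [sees v] gives a seen [e] linked to an [f] with an end missed by [v]; this end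
    lies in [A], hence differs from [v]. *)
Lemma chain_attach A s v : chain A s -> v \notin A -> has (sees v) s -> ~~ all (sees v) s ->
  exists e w, e \in s /\ link G e (v, w).
Proof.
move=> cs vA hs ns; have [e [f [es fs ef ve vf]]] := chain_cut cs hs ns.
have fA x : x \in ends f -> v != x.
  move=> xf; apply: contraNneq vA => ->; apply: (subsetP (chain_sub cs)).
  by rewrite inE; apply/hasP; exists f.
have /and5P[ne _ a11 a12 /andP[a21 a22]] := ef; have /andP[v1 v2] := ve.
have [f1 f2] : v != f.1 /\ v != f.2 by split; apply: fA; rewrite !inE eqxx ?orbT.
move: vf; rewrite negb_and => /orP[vf|vf]; [exists e, f.1|exists e, f.2]; split => //.
all: by apply/and5P; rewrite /nonedge /= ?f1 ?f2 ?vf ?a11 ?a12 ?a21 ?a22 !(adj_sym _ _ v) v1 v2.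
Qed.

Lemma chain_extend A s t :
    (forall Y : {set T}, clique G Y -> #|Y| <= t) -> chain A s ->
    t < #|A| ->
    (s != [::] -> exists2 e, e \in s & t < #|[set w in A :\: verts s | sees w e]|) ->
  exists e, chain A (e :: s).
Proof.
move=> cl cs tA hs.
have [Y [tY /subsetP YA Ye]] : exists Y : {set T}, [/\ t < #|Y|, Y \subset A :\: verts s &
    nilp s || has (fun e => [forall w in Y, sees w e]) s].
  have [sn|/hs[e es te]] := eqVneq s [::].
    exists A; split; rewrite ?sn //.
    by apply/subsetP => x xA; rewrite !inE /= xA.
  exists [set w in A :\: verts s | sees w e]; split => //.
    by apply/subsetP => x; rewrite inE => /andP[].
  apply/orP; right; apply/hasP; exists e => //.
  by apply/forall_inP => w; rewrite inE => /andP[].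
have : ~~ clique G Y by apply: contraL tY => /cl; rewrite -leqNgt.
rewrite negb_forall => /existsP[x]; rewrite negb_imply => /andP[xY].
rewrite negb_forall => /existsP[y]; rewrite negb_imply => /andP[yY].
rewrite negb_imply => /andP[xy nxy].
exists (x, y); have ne : nonedge G (x, y) by apply/andP.
apply/and5P; split => //.
- by apply/subsetP => z; rewrite !inE => /orP[]/eqP->; [have := YA x xY|have := YA y yY]; rewrite inE => /andP[].
- rewrite disjoint_subset; apply/subsetP => z.
  by rewrite !inE => /orP[]/eqP->; [have := YA x xY|have := YA y yY]; rewrite !inE => /andP[].
- case/orP: Ye => [->//|/hasP[e es /forall_inP He]]; apply/orP; right.
  apply/hasP; exists e => //; have /andP[x1 x2] := He x xY; have /andP[y1 y2] := He y yY.
  by apply/and5P; rewrite ne (chain_nonedge cs es) x1 x2 y1 y2.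
Qed.

Lemma exists_chain A h :
    (forall s, size s < h -> chain A s -> exists e, chain A (e :: s)) ->
  exists2 s, size s = h & chain A s.
Proof.
elim: h => [|h IH] H; first by exists [::].
have [s sh cs] := IH (fun s sh => H s (ltnW sh)).
by have [e ce] := H s (eq_leq (f_equal S sh)) cs; exists (e :: s); rewrite //= sh.
Qed.

(** One link between the chains puts both in the same component; each vertex is then attached to the
    chain of the half that does not contain it. *)
Lemma CFS_of_chains A sA sB :
    chain A sA -> chain (~: A) sB ->
    (forall v, v \notin A -> has (sees v) sA && ~~ all (sees v) sA) ->
    (forall v, v \in A -> has (sees v) sB && ~~ all (sees v) sB) ->
    (exists e f, [/\ e \in sA, f \in sB, sees e.1 f & sees e.2 f]) ->
  CFS G.
Proof.
move=> cA cB hA hB [e0 [f0 [e0A f0B /andP[a11 a12] /andP[a21 a22]]]].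
have ef : link G e0 f0.
  by apply/and5P; rewrite (chain_nonedge cA) ?(chain_nonedge cB) ?a11 ?a12 ?a21 ?a22.
apply: (CFS_of_link ef) => v _ _.
have [vA|vA] := boolP (v \in A).
  have /andP[h1 h2] := hB _ vA.
  have [|e [w [eB ew]]] := chain_attach cB _ h1 h2; first by rewrite inE negbK.
  exists w; apply: connect_trans (connect1 ef) _.
  exact: connect_trans (chain_connect cB f0B eB) (connect1 ew).
have /andP[h1 h2] := hA _ vA.
have [e [w [eA ew]]] := chain_attach cA vA h1 h2.
by exists w; exact: connect_trans (chain_connect cA e0A eA) (connect1 ew).
Qed.

End Chain.

(** * Edge sets of the random graph *)

Lemma set2_inj (T : finType) (x y x' y' : T) :
  [set x; y] = [set x'; y'] -> (x = x' /\ y = y') \/ (x = y' /\ y = x').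
Proof.
move=> eq2; have := set21 x y; have := set22 x y; have := set21 x' y'; have := set22 x' y'.
rewrite eq2 -{1 2}eq2 !inE.
by do 4![case/orP => /eqP ?]; subst; auto.
Qed.

Section EdgeSets.
Variable n : nat.
Implicit Types (E : {set possible_edge n}) (X Y A : {set 'I_n}).

(** With [cross] and [inner], adjacency conditions become inclusions of a fixed block of edges in
    [E], as the block bounds require. *)
Definition cross X Y : {set possible_edge n} :=
  [set e : possible_edge n | [exists x in X, exists y in Y, val e == [set x; y]]].

Definition inner Y : {set possible_edge n} := [set e : possible_edge n | val e \subset Y].

Lemma crossP X Y (e : possible_edge n) :
  reflect (exists x y, [/\ x \in X, y \in Y & val e = [set x; y]]) (e \in cross X Y).
Proof.
rewrite inE; apply: (iffP exists_inP) => [[x xX /exists_inP[y yY /eqP exy]]|[x [y [xX yY exy]]]].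
  by exists x, y.
by exists x => //; apply/exists_inP; exists y => //; apply/eqP.
Qed.

Lemma adjP E x y :
  reflect (exists2 e, e \in E & val e = [set x; y]) (adj (graph_of_edges E) x y).
Proof. by apply: (iffP exists_inP) => -[e eE /eqP h]; exists e => //; apply/eqP. Qed.

Lemma edge_of (x y : 'I_n) : x != y -> exists e : possible_edge n, val e = [set x; y].
Proof.
move=> xy; have h : #|[set x; y]| == 2 by rewrite cards2 xy.
by exists (Sub [set x; y] h).
Qed.

Lemma cross_sub X Y E : [disjoint X & Y] ->
  (cross X Y \subset E) = [forall x in X, forall y in Y, adj (graph_of_edges E) x y].
Proof.
move=> XY; apply/subsetP/forall_inP => [H x xX|H e /crossP[x [y [xX yY exy]]]].
  apply/forall_inP => y yY; have [|e exy] := @edge_of x y.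
    by apply: contraTneq yY => <-; rewrite (disjointFr XY).
  by apply/adjP; exists e => //; apply: H; apply/crossP; exists x, y.
have /adjP[e' e'E e'xy] := forall_inP (H x xX) y yY.
by rewrite (_ : e = e') //; apply: val_inj; rewrite exy e'xy.
Qed.

Lemma inner_sub Y E : (inner Y \subset E) = clique (graph_of_edges E) Y.
Proof.
apply/subsetP/forall_inP => [H x xY|H e].
  apply/forall_inP => y yY; apply/implyP => xy; have [e exy] := edge_of xy.
  apply/adjP; exists e => //; apply: H; rewrite inE exy.
  by apply/subsetP => z; rewrite !inE => /orP[]/eqP->.
rewrite inE => eY; have := valP e => /cards2P[x [y [xy exy]]].
rewrite exy in eY; have [xY yY] : x \in Y /\ y \in Y.
  by split; apply: (subsetP eY); rewrite !inE eqxx ?orbT.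
have /adjP[e' e'E e'xy] := implyP (forall_inP (H x xY) y yY) xy.
by rewrite (_ : e = e') //; apply: val_inj; rewrite exy e'xy.
Qed.

Lemma card_cross X Y : [disjoint X & Y] -> #|cross X Y| = #|X| * #|Y|.
Proof.
move=> XY; rewrite -cardsX -(card_imset _ val_inj).
have -> : val @: cross X Y = [set [set u.1; u.2] | u in setX X Y].
  apply/setP => S; apply/imsetP/imsetP => [[e /crossP[x [y [xX yY exy]]] ->]|[[x y] /setXP[xX yY] ->]].
    by exists (x, y) => //; apply/setXP.
  have [|e exy] := @edge_of x y; first by apply: contraTneq yY => <-; rewrite (disjointFr XY).
  by exists e => //; apply/crossP; exists x, y.
apply: card_in_imset => -[x y] [x' y'] /setXP[xX yY] /setXP[x'X y'Y] /= /set2_inj[[-> ->//]|[xy' _]].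
by rewrite xy' (disjointFl XY) in xX.
Qed.

Lemma card_inner Y : #|inner Y| = 'C(#|Y|, 2).
Proof.
rewrite -cards_draws -(card_imset _ val_inj); congr #|pred_of_set _|; apply/setP => S.
rewrite inE; apply/imsetP/andP => [[e]|[SY S2]].
  by rewrite inE => eY ->; split => //; exact: (valP e).
by exists (Sub S S2 : possible_edge n); rewrite ?inE.
Qed.

(** [A] tells the two ends of a crossing edge apart, so a common edge would give a common vertex on
    each side. *)
Lemma cross_disjoint A X Y X' Y' :
    X \subset A -> X' \subset A -> Y \subset ~: A -> Y' \subset ~: A ->
    [disjoint X & X'] || [disjoint Y & Y'] ->
  [disjoint cross X Y & cross X' Y'].
Proof.
move=> XA X'A YA Y'A; apply: contraTT => /pred0Pn[e /= /andP[/crossP[x [y [xX yY exy]]]]].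
case/crossP => x' [y' [xX' yY' exy']]; rewrite exy in exy'; rewrite negb_or.
have [[xx yy]|[xy _]] := set2_inj exy'.
  apply/andP; split; apply/pred0Pn; [exists x|exists y]; apply/andP; split => //=.
    by rewrite xx.
  by rewrite yy.
by have := subsetP Y'A _ yY'; rewrite -xy inE (subsetP XA).
Qed.

(** This is what makes the edges between the halves independent of the chains within them. *)
Lemma cross_inner A X Y : X \subset A -> Y \subset ~: A ->
  [disjoint cross X Y & inner A :|: inner (~: A)].
Proof.
move=> XA YA; rewrite disjoint_subset; apply/subsetP => e /crossP[x [y [xX yY exy]]].
have xA := subsetP XA _ xX; have := subsetP YA _ yY; rewrite inE => yA.
rewrite !inE exy negb_or; apply/andP; split; apply/subsetPn.
  by exists y; rewrite // !inE eqxx orbT.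
by exists x; rewrite // !inE ?eqxx ?xA.
Qed.

Lemma sees_cross E A e v : ends e \subset A -> v \notin A ->
  sees (graph_of_edges E) v e = (cross (ends e) [set v] \subset E).
Proof.
move=> eA vA; rewrite cross_sub; last first.
  by rewrite disjoint_sym disjoints1; apply: contra vA; apply: subsetP.
apply/andP/forall_inP => [[h1 h2] x xe|H].
  by apply/forall_inP => y; rewrite inE => /eqP->; rewrite adj_sym; move: xe; rewrite !inE => /orP[]/eqP->.
by split; rewrite adj_sym; apply: (forall_inP (H _ _)); rewrite ?inE ?eqxx ?orbT.
Qed.

End EdgeSets.

(** * Sparse graphs *)

Lemma chain_card_verts (T : finType) (G : graph T) A s : chain G A s -> #|verts s| = 2 * size s.
Proof.
elim: s => [_|e s IH /and5P[/andP[e12 _] _ dis _ /IH{}IH]].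
  by apply/eqP; rewrite cards_eq0; apply/eqP/setP => x; rewrite !inE.
rewrite verts_cons cardsU disjoint_setI0 // cards0 subn0 IH mulnS.
by rewrite cards2 e12.
Qed.

(* The part of the definition of a chain that does not depend on the graph: the union bound ranges
   over all spread sequences. *)
Definition spread (T : finType) (A : {set T}) (s : seq (T * T)) :=
  [&& uniq s, verts s \subset A &
      all (fun e => all (fun f => (e != f) ==> [disjoint ends e & ends f]) s) s].

Lemma spread_disjoint (T : finType) (A : {set T}) s e f :
  spread A s -> e \in s -> f \in s -> e != f -> [disjoint ends e & ends f].
Proof. by case/and3P => _ _ /allP H es fs; apply/implyP; apply: (allP (H e es)). Qed.

Lemma ends_verts (T : finType) (s : seq (T * T)) e : e \in s -> ends e \subset verts s.
Proof. by move=> es; apply/subsetP => x xe; rewrite inE; apply/hasP; exists e. Qed.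

Lemma chain_spread (T : finType) (G : graph T) A s : chain G A s -> spread A s.
Proof.
move=> cs; apply/and3P; split; last 1 first.
- elim: s cs => //= e s IH /and5P[_ _ dis _ /IH {}IH].
  have disj f : f \in s -> [disjoint ends e & ends f].
    by move=> fs; apply: disjointWr dis; exact: ends_verts.
  rewrite eqxx /=; apply/andP; split; first by apply/allP => f /disj ->; rewrite implybT.
  apply/allP => f fs /=; rewrite disjoint_sym disj // implybT /=.
  exact: (allP IH).
- elim: s cs => //= e s IH /and5P[_ _ dis _ /IH ->]; rewrite andbT.
  apply: contraTN dis => es; rewrite -setI_eq0; apply/set0Pn; exists e.1.
  by rewrite inE (subsetP (ends_verts es)) !inE eqxx.
- exact: chain_sub cs.
Qed.

(** Lets a chain survive the resampling of all edges not inside [A]. *)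
Lemma eq_chain (T : finType) (G G' : graph T) (A : {set T}) s :
  {in A &, forall x y, adj G x y = adj G' x y} -> chain G A s -> chain G' A s.
Proof.
move=> GG; elim: s => //= e s IH /and5P[ne eA dis h cs].
have inA e' i : ends e' \subset A -> i \in ends e' -> i \in A by move/subsetP; apply.
have neq e' : ends e' \subset A -> nonedge G e' = nonedge G' e'.
  by move=> h'; rewrite /nonedge GG //; apply: (inA _ _ h'); rewrite !inE eqxx ?orbT.
rewrite -neq // ne eA dis IH // andbT.
case/orP: h => [->//|/hasP[f fs ef]]; apply/orP; right; apply/hasP; exists f => //.
have fA : ends f \subset A := subset_trans (ends_verts fs) (chain_sub cs).
move: ef; rewrite /link -!neq // !GG //.
all: first [by apply: (inA _ _ eA); rewrite !inE eqxx ?orbT | by apply: (inA _ _ fA); rewrite !inE eqxx ?orbT].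
Qed.

Section Sparse.
Variables (R : realFieldType) (n : nat) (p : R).
Hypothesis p01 : (0 <= p <= 1)%R.
Local Open Scope ring_scope.
Implicit Types (A Y : {set 'I_n}) (E F : {set possible_edge n}).

Notation GE := (@graph_of_edges n).

Definition has_clique t (E : {set possible_edge n}) :=
  [exists Y : {set 'I_n}, (#|Y| == t) && clique (GE E) Y].

Lemma Pr_has_clique t : Pr p (has_clique t) <= n%:R ^+ t * p ^+ 'C(t, 2).
Proof.
apply: le_trans (Pr_exists p01 _ (fun Y E => clique (GE E) Y)) _.
rewrite (eq_bigr (fun=> p ^+ 'C(t, 2))); last first.
  move=> Y /eqP Yt; rewrite -Yt -card_inner -Pr_sub.
  by apply: eq_Ex => E; rewrite inner_sub.
rewrite sumr_const -[X in _ *+ X](@eq_card _ [set Y : {set 'I_n} | #|Y| == t]); last first.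
  by move=> Y; rewrite inE.
rewrite card_draws card_ord -[X in X <= _]mulr_natl; apply: ler_wpM2r; first by rewrite exprn_ge0 // (andP p01).1.
rewrite -natrX ler_nat (leq_trans (leq_pmulr _ (fact_gt0 t))) // bin_ffact.
by elim: t => // t IH; rewrite ffactnSr expnSr leq_mul // leq_subr.
Qed.

(** The failure of the last hypothesis of [chain_extend], stated for arbitrary sequences so that a
    union bound applies. *)
Definition stuck A t s (E : {set possible_edge n}) :=
  all (fun e => #|[set w in A :\: verts s | sees (GE E) w e]| <= t)%N s.

Lemma Pr_stuck A t s (l : R) : 0 < l <= 1 -> spread A s ->
  Pr p (stuck A t s) <= l^-1 ^+ (t * size s) * (1 - (1 - l) * p ^+ 2) ^+ (size s * #|A :\: verts s|).
Proof.
move=> l01 sp; set W := A :\: verts s.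
pose r := [seq (e, w) | e <- s, w <- enum W].
pose B (u : 'I_n * 'I_n * 'I_n) := cross (ends u.1) [set u.2].
have us : uniq s by case/and3P: sp.
have memr u : u \in r -> u.1 \in s /\ u.2 \notin verts s.
  by case/allpairsP => -[e w] /= [es]; rewrite mem_enum => /setDP[_ wv] ->.
have endsV u : u \in r -> ends u.1 \subset verts s by case/memr => us1 _; apply: ends_verts.
have szr : size r = (size s * #|W|)%N by rewrite size_allpairs -cardE.
rewrite -szr; apply: le_trans (Pr_few_blocks p01 (B := B) _ l01 _ _ _); first last.
- move=> u ur; rewrite /B card_cross; last first.
    rewrite disjoint_sym disjoints1; apply: contra (memr _ ur).2.
    exact: subsetP (endsV _ ur) _.
  by rewrite cards1 muln1 cards2 ltnS leq_b1.
- move=> u v ur vr uv; apply: (@cross_disjoint _ (verts s)); rewrite ?endsV //.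
  + by rewrite sub1set inE (memr _ ur).2.
  + by rewrite sub1set inE (memr _ vr).2.
  have [uv1|uv1] := eqVneq u.1 v.1; last first.
    by rewrite (spread_disjoint sp _ _ uv1) ?(memr _ ur).1 ?(memr _ vr).1.
  apply/orP; right; rewrite disjoints1 inE; apply: contraNneq uv => uv2.
  by apply/eqP; case: u v uv1 uv2 {ur vr} => ? ? [? ?] /= -> ->.
- by apply: allpairs_uniq; rewrite ?enum_uniq // => -[? ?] [? ?].
apply: (le_Pr p01) => E /allP H.
rewrite count_flatten -map_comp.
have few e : e \in s -> (count (fun u => B u \subset E) [seq (e, w) | w <- enum W] <= t)%N.
  move=> es; apply: leq_trans (H e es); rewrite count_map -size_filter cardE.
  apply: uniq_leq_size; first by rewrite filter_uniq ?enum_uniq.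
  move=> w; rewrite mem_filter /= !mem_enum => /andP[eE wW]; rewrite inE wW /=.
  rewrite (sees_cross _ (ends_verts es)) //; by move: wW; rewrite inE => /andP[].
elim: (s) few => // e s' IH few; rewrite mulnS /= leq_add ?few ?mem_head //.
by apply: IH => f fs; apply: few; rewrite inE fs orbT.
Qed.

Lemma card_setD_verts A s h : (size s < h)%N -> (#|A| - 2 * h <= #|A :\: verts s|)%N.
Proof.
move=> sh; rewrite cardsD leq_sub2l // (leq_trans (subset_leq_card (subsetIr _ _))) //.
by rewrite (leq_trans (card_verts s)) // leq_mul2l ltnW.
Qed.

Definition has_chain A h (E : {set possible_edge n}) :=
  [exists s : h.-tuple ('I_n * 'I_n), chain (GE E) A s].

(** Greedy growth stops before length [h] only at a large clique or a stuck chain. Length 0 is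
    excluded because the empty sequence is stuck vacuously, and [t < #|A|] takes care of it. *)
Lemma has_chainN A t h E : (t < #|A|)%N -> ~~ has_chain A h E ->
  has_clique t.+1 E || [exists k : 'I_h, (0 < k)%N &&
    [exists s : k.-tuple ('I_n * 'I_n), spread A s && stuck A t s E]].
Proof.
move=> tA; apply: contraNT; rewrite negb_or => /andP[ncl ns].
have [s sh cs] : exists2 s, size s = h & chain (GE E) A s.
  apply: exists_chain => s sh cs; apply: (@chain_extend _ _ _ _ t) => //.
    move=> Y cY; rewrite leqNgt; apply: contra ncl => tY.
    (* A larger clique is cut down to exactly [t.+1] vertices, the size in the union bound. *)
    have : (0 < #|[set Y' : {set 'I_n} | (Y' \subset Y) && (#|Y'| == t.+1)]|)%N.
      by rewrite cards_draws bin_gt0.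
    case/card_gt0P => Y'; rewrite inE => /andP[/subsetP Y'Y Y't].
    apply/existsP; exists Y'; rewrite Y't; apply/forall_inP => x xY; apply/forall_inP => y yY.
    exact: (forall_inP (forall_inP cY x (Y'Y _ xY)) y (Y'Y _ yY)).
  move=> sn; apply/exists_inP; apply: contraNT ns; rewrite negb_exists => /forallP st.
  apply/existsP; exists (Ordinal sh); apply/andP; split; first by rewrite lt0n size_eq0.
  apply/existsP; exists (in_tuple s); rewrite (chain_spread cs) /=.
  by apply/allP => e es; have := st e; rewrite es /= -leqNgt.
by move/eqP: sh => sh; apply/existsP; exists (Tuple sh).
Qed.

Lemma Pr_has_chainN A t h (l : R) : 0 < l <= 1 -> (t < #|A|)%N ->
  Pr p (fun E => ~~ has_chain A h E) <=
    n%:R ^+ t.+1 * p ^+ 'C(t.+1, 2) +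
    \sum_(k < h | (0 < k)%N)
      (n%:R ^+ 2 * (l^-1 ^+ t * (1 - (1 - l) * p ^+ 2) ^+ (#|A| - 2 * h))) ^+ k.
Proof.
move=> l01 tA; have /andP[l0 l1] := l01; have /andP[p0 p1] := p01.
apply: le_trans (le_Pr p01 (fun E => @has_chainN A t h E tA)) _.
apply: le_trans (Pr_or p01 _ _) _; apply: lerD; first exact: Pr_has_clique.
apply: le_trans (Pr_exists p01 _ (fun (k : 'I_h) E =>
  [exists s : k.-tuple ('I_n * 'I_n), spread A s && stuck A t s E])) _.
apply: ler_sum => k k0.
apply: le_trans (Pr_exists p01 _ (fun (s : k.-tuple ('I_n * 'I_n)) E => stuck A t s E)) _.
set c := 1 - (1 - l) * p ^+ 2.
have c01 : 0 <= c <= 1.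
  rewrite /c subr_ge0 lerBlDr lerDl mulr_ge0 ?subr_ge0 ?exprn_ge0 // andbT.
  by rewrite mulr_ile1 ?subr_ge0 ?exprn_ge0 ?exprn_ile1 // lerBlDr lerDl ltW.
have /andP[c0 c1] := c01.
apply: le_trans (_ : \sum_(s : k.-tuple ('I_n * 'I_n)) (l^-1 ^+ t * c ^+ (#|A| - 2 * h)) ^+ k <= _).
  rewrite big_mkcond; apply: ler_sum => s _; case: ifP => [sp|_]; last first.
    by rewrite exprn_ge0 // mulr_ge0 // exprn_ge0 // invr_ge0 ltW.
  apply: le_trans (Pr_stuck _ l01 sp) _; rewrite size_tuple exprMn -!exprM.
  apply: ler_wpM2l; first by rewrite exprn_ge0 // invr_ge0 ltW.
  rewrite [X in c ^+ X <= _]mulnC ler_wiXn2l // leq_mul2r.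
  by rewrite card_setD_verts ?orbT // size_tuple.
by rewrite sumr_const card_tuple card_prod card_ord -[X in X <= _]mulr_natl natrX natrM -expr2 -exprMn.
Qed.

(** * Exposing the edges between the two halves *)

Definition attached E s v := has (sees (GE E) v) s && ~~ all (sees (GE E) v) s.

(** Failure means that [v] sees no member, so none of the disjoint two-edge blocks is present, or
    all of them, so all [2 * size s] edges are. The chain is fixed in [G] while [E] is random. *)
Lemma Pr_attachedN G A s v : chain G A s -> v \notin A ->
  Pr p (fun E => ~~ attached E s v) <= (1 - p ^+ 2) ^+ size s + p ^+ (2 * size s).
Proof.
move=> cs vA; have sA := chain_sub cs; have sp := chain_spread cs.
have eA e : e \in s -> ends e \subset A by move=> es; apply: subset_trans (ends_verts es) sA.
have dv (X : {set _}) : X \subset A -> [disjoint X & [set v]].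
  by move=> XA; rewrite disjoint_sym disjoints1; apply: contra vA; apply: subsetP.
apply: le_trans (_ : Pr p (fun E => all (fun e => ~~ (cross (ends e) [set v] \subset E)) s
   || (cross (verts s) [set v] \subset E)) <= _).
  apply: (le_Pr p01) => E; rewrite negb_and negbK => /orP[nh|al]; apply/orP; [left|right].
    apply/allP => e es; rewrite -(sees_cross _ (eA e es)) //.
    by apply: contra nh => ve; apply/hasP; exists e.
  rewrite cross_sub ?dv //; apply/forall_inP => x; rewrite inE => /hasP[e es xe].
  apply/forall_inP => y; rewrite inE => /eqP->; have /andP[h1 h2] := allP al e es.
  by move: xe; rewrite adj_sym !inE => /orP[]/eqP->.
apply: le_trans (Pr_or p01 _ _) (lerD _ _); last first.
  by rewrite Pr_sub card_cross ?dv // cards1 muln1 (chain_card_verts cs).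
apply: (Pr_no_block p01).
- by case/and3P: sp.
- move=> e f es fs ef; apply: (@cross_disjoint _ A); rewrite ?eA ?sub1set ?inE //.
  by rewrite (spread_disjoint sp).
- by move=> e es; rewrite card_cross ?dv ?eA // cards1 muln1 cards2 ltnS leq_b1.
Qed.

Definition joined E s s' :=
  has (fun e => has (fun f => sees (GE E) e.1 f && sees (GE E) e.2 f) s') s.

(** Each choice of one member from each chain has its own block of at most four edges, and these
    blocks are disjoint. *)
Lemma Pr_joinedN G A s s' : chain G A s -> chain G (~: A) s' ->
  Pr p (fun E => ~~ joined E s s') <= (1 - p ^+ 4) ^+ (size s * size s').
Proof.
move=> cs cs'; have sA := chain_sub cs; have sp := chain_spread cs.
have sA' := chain_sub cs'; have sp' := chain_spread cs'.
have eA e : e \in s -> ends e \subset A by move=> es; apply: subset_trans (ends_verts es) sA.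
have eA' e : e \in s' -> ends e \subset ~: A by move=> es; apply: subset_trans (ends_verts es) sA'.
have dis e f : e \in s -> f \in s' -> [disjoint ends e & ends f].
  move=> es fs; rewrite disjoints_subset (subset_trans (eA _ es)) // -(setCK A) setCS.
  exact: eA'.
pose r := [seq (e, f) | e <- s, f <- s'].
pose B (u : ('I_n * 'I_n) * ('I_n * 'I_n)) := cross (ends u.1) (ends u.2).
have memr u : u \in r -> u.1 \in s /\ u.2 \in s' by case/allpairsP => -[e f] /= [es fs ->].
rewrite -(size_allpairs pair) -/r.
apply: le_trans (Pr_no_block p01 (B := B) _ _ _); first last.
- move=> u /memr[us us']; rewrite /B card_cross ?dis // !cards2.
  by do 2!case: (_ != _).
- move=> u v /memr[us us'] /memr[vs vs'] uv; apply: (@cross_disjoint _ A); rewrite ?eA ?eA' //.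
  have [uv1|uv1] := eqVneq u.1 v.1; last by rewrite (spread_disjoint sp).
  rewrite (spread_disjoint sp' us' vs') ?orbT //; apply: contraNneq uv => uv2.
  by apply/eqP; case: u v uv1 uv2 {us us' vs vs'} => ? ? [? ?] /= -> ->.
- by apply: allpairs_uniq; [case/and3P: sp|case/and3P: sp'|move=> [? ?] [? ?]].
apply: (le_Pr p01) => E nj; apply/allP => u ur; apply: contra nj; have [us us'] := memr u ur.
rewrite /B cross_sub ?dis // => /forall_inP H.
apply/hasP; exists u.1 => //; apply/hasP; exists u.2 => //.
by rewrite /sees !(forall_inP (H _ _)) // !inE eqxx ?orbT.
Qed.

Lemma adj_mix A F E1 E2 x y : inner A \subset F -> x \in A -> y \in A ->
  adj (GE (mix F E1 E2)) x y = adj (GE E1) x y.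
Proof.
move=> AF xA yA.
have inF (e : possible_edge n) : val e = [set x; y] -> e \in F.
  move=> exy; apply: (subsetP AF); rewrite inE exy; apply/subsetP => z.
  by rewrite !inE => /orP[]/eqP->.
apply/adjP/adjP => -[e eE exy]; exists e => //; have eF := inF e exy.
  by move: eE; rewrite !inE eF andbT /= orbF.
by rewrite !inE eF eE.
Qed.

Lemma chain_mix A F E1 E2 s : inner A \subset F ->
  chain (GE E1) A s -> chain (GE (mix F E1 E2)) A s.
Proof. by move=> AF; apply: eq_chain => x y xA yA; rewrite (@adj_mix A). Qed.

Lemma attached_mix A E1 E2 s v (F := inner A :|: inner (~: A)) :
  verts s \subset A -> v \notin A -> attached (mix F E1 E2) s v = attached E2 s v.
Proof.
move=> sA vA; have eq : {in s, sees (GE (mix F E1 E2)) v =1 sees (GE E2) v}.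
  move=> e es; have eA := subset_trans (ends_verts es) sA.
  by rewrite !(sees_cross _ eA vA) mix_subr // cross_inner // sub1set inE.
by rewrite /attached (eq_in_has eq) (eq_in_all eq).
Qed.

Lemma joined_mix A E1 E2 s s' (F := inner A :|: inner (~: A)) :
  verts s \subset A -> verts s' \subset ~: A -> joined (mix F E1 E2) s s' = joined E2 s s'.
Proof.
move=> sA sA'; apply: eq_in_has => e es; apply: eq_in_has => f fs.
have eA := subset_trans (ends_verts es) sA; have fA := subset_trans (ends_verts fs) sA'.
have key v : v \in A -> sees (GE (mix F E1 E2)) v f = sees (GE E2) v f.
  move=> vA; have vA' : v \notin ~: A by rewrite inE negbK.
  have EF : F = inner (~: A) :|: inner (~: ~: A) by rewrite setCK setUC.
  by rewrite !(sees_cross _ fA vA') mix_subr // EF cross_inner // sub1set inE.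
by congr (_ && _); apply: key; apply: (subsetP eA); rewrite !inE eqxx ?orbT.
Qed.

(** [E1] supplies the edges inside the halves and [E2] those between. Once [E1] contains both chains
    they are fixed, and only the events of attaching every vertex and joining the chains, which
    depend on [E2], remain. *)
Lemma Pr_CFSN_chains A h :
  Pr p (fun E => ~~ CFS (GE E)) <=
    Pr p (fun E => ~~ has_chain A h E) + Pr p (fun E => ~~ has_chain (~: A) h E)
    + (n%:R * ((1 - p ^+ 2) ^+ h + p ^+ (2 * h)) + (1 - p ^+ 4) ^+ (h * h)).
Proof.
have /andP[p0 p1] := p01.
set d := _ + (1 - _) ^+ (h * h).
have pk k : 0 <= 1 - p ^+ k by rewrite subr_ge0 exprn_ile1.
have d0 : 0 <= d.
  by rewrite /d; apply: addr_ge0; rewrite ?exprn_ge0 // mulr_ge0 // addr_ge0 // exprn_ge0.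
pose F := inner A :|: inner (~: A).
rewrite [X in X <= _](Ex_mix p F) -[X in _ <= _ + X](Ex_cst (possible_edge n) p d) /Pr -!ExD; apply: (le_Ex p01) => E1.
case: (boolP (has_chain A h E1)) => [/existsP[s cs]|_]; last first.
  by rewrite (le_trans (Pr_le1 p01 _)) // -addrA lerDl addr_ge0 // ler0n.
case: (boolP (has_chain (~: A) h E1)) => [/existsP[s' cs']|_]; last first.
  by rewrite (le_trans (Pr_le1 p01 _)) // add0r lerDl.
rewrite !add0r; have sA := chain_sub cs; have sA' := chain_sub cs'.
have AF : inner A \subset F by apply: subsetUl.
have AF' : inner (~: A) \subset F by apply: subsetUr.
pose ss v := if v \in A then s' : seq _ else s.
apply: le_trans (_ : Pr p (fun E => [exists v, true && ~~ attached E (ss v) v] || ~~ joined E s s') <= _).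
  apply: (le_Pr p01) => E2; apply: contraNT; rewrite negb_or negb_exists negbK => /andP[/forallP att jn].
  apply: (@CFS_of_chains _ _ A s s').
  - exact: chain_mix.
  - exact: chain_mix.
  - move=> v vA; have := att v; rewrite /ss (negbTE vA) /= negbK => h1.
    by rewrite -(attached_mix E1 _ sA) // in h1.
  - move=> v vA; have := att v; rewrite /ss vA /= negbK => h1.
    rewrite -(attached_mix E1 _ sA') ?inE ?vA // in h1.
    by rewrite setCK setUC in h1.
  - rewrite -(joined_mix E1 _ sA sA') in jn; have /hasP[e es /hasP[f fs /andP[h1 h2]]] := jn.
    by exists e, f.
apply: le_trans (Pr_or p01 _ _) (lerD _ _); last first.
  by apply: le_trans (Pr_joinedN cs cs') _; rewrite !size_tuple.
apply: le_trans (Pr_exists p01 _ (fun v E => ~~ attached E (ss v) v)) _.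
rewrite -[X in X%:R](card_ord n) -[X in X * _]/(_ *+ _) mulr_natl -sumr_const; apply: ler_sum => v _.
rewrite /ss; case: ifP => vA.
  have vA' : v \notin ~: A by rewrite inE vA.
  by apply: le_trans (Pr_attachedN cs' vA') _; rewrite size_tuple.
by apply: le_trans (Pr_attachedN cs (negbT vA)) _; rewrite size_tuple.
Qed.

Lemma Pr_CFSN_sparse t h (l : R) (r := n%:R ^+ 2 * (l^-1 ^+ t * (1 - (1 - l) * p ^+ 2) ^+ (2 * h))) :
    0 < l <= 1 -> (8 * h <= n)%N -> (t < 4 * h)%N -> r <= 1 ->
  Pr p (fun E => ~~ CFS (graph_of_edges E)) <=
    2%:R * (n%:R ^+ t.+1 * p ^+ 'C(t.+1, 2) + n%:R * r)
    + (n%:R * ((1 - p ^+ 2) ^+ h + p ^+ (2 * h)) + (1 - p ^+ 4) ^+ (h * h)).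
Proof.
move=> l01 hn th r1; have /andP[l0 l1] := l01; have /andP[p0 p1] := p01.
have c01 : 0 <= 1 - (1 - l) * p ^+ 2 <= 1.
  rewrite subr_ge0 lerBlDr lerDl mulr_ge0 ?subr_ge0 ?exprn_ge0 // andbT.
  by rewrite mulr_ile1 ?subr_ge0 ?exprn_ge0 ?exprn_ile1 // lerBlDr lerDl ltW.
have /andP[c0 c1] := c01.
have li0 : 0 <= l^-1 by rewrite invr_ge0 ltW.
have r0 : 0 <= r by rewrite /r !mulr_ge0 ?exprn_ge0.
pose A : {set 'I_n} := [set i : 'I_n | (i < 4 * h)%N].
have cA : #|A| = (4 * h)%N.
  have hn' : (4 * h <= n)%N by lia.
  have winj : injective (widen_ord hn') by move=> i j /(congr1 val) /= /val_inj.
  rewrite -[RHS]card_ord -(card_imset _ winj); apply: eq_card => i.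
  rewrite inE; apply/idP/imsetP => [ih|[j _ ->]]; last exact: (ltn_ord j).
  by exists (Ordinal ih) => //; apply: val_inj.
have cA' : #|~: A| = (n - 4 * h)%N by rewrite cardsCs setCK cA card_ord.
have side (B : {set 'I_n}) : (4 * h <= #|B|)%N -> Pr p (fun E => ~~ has_chain B h E)
    <= n%:R ^+ t.+1 * p ^+ 'C(t.+1, 2) + n%:R * r.
  move=> hB; apply: le_trans (Pr_has_chainN h l01 (leq_trans th hB)) _; rewrite lerD2l.
  apply: le_trans (_ : \sum_(k < h) r <= _).
    rewrite big_mkcond; apply: ler_sum => k _; case: ifP => // k0.
    apply: le_trans (_ : r ^+ k <= _); last by rewrite -{2}[r]expr1 ler_wiXn2l.
    apply: lerXn2r; rewrite ?nnegrE ?mulr_ge0 ?exprn_ge0 //.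
    apply: ler_wpM2l; first by rewrite exprn_ge0.
    apply: ler_wpM2l; first by rewrite exprn_ge0.
    by apply: ler_wiXn2l => //; lia.
  rewrite sumr_const card_ord -[X in X <= _]mulr_natl ler_wpM2r // ler_nat; lia.
apply: le_trans (Pr_CFSN_chains A h) _; rewrite lerD2r mulrDl mul1r.
by apply: lerD; apply: side; lia.
Qed.

End Sparse.

(** * Dense graphs *)

Section CommonLinks.
Variables (R : realFieldType) (n : nat) (p : R).
Hypothesis p01 : (0 <= p <= 1)%R.
Local Open Scope ring_scope.
Implicit Types (X Y : {set 'I_n}) (E F : {set possible_edge n}) (e f : possible_edge n).

Notation GE := (@graph_of_edges n).

Definition common E X : {set 'I_n} := [set w in ~: X | cross X [set w] \subset E].

Definition clique_common e f E :=
  [disjoint [set e; f] & E] && clique (GE E) (common E (val e :|: val f)).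

Lemma adj_edgeN E x y : x != y -> ~~ adj (GE E) x y ->
  exists2 e : possible_edge n, val e = [set x; y] & e \notin E.
Proof.
move=> xy nxy; have [e exy] := edge_of xy; exists e => //.
by apply: contra nxy => eE; apply/adjP; exists e.
Qed.

(** Otherwise there is a non-edge, and for any two non-edges a non-edge in the common neighbourhood
    of their ends is linked to both. *)
Lemma CFSN_clique_common E : ~~ CFS (GE E) ->
  ([set: possible_edge n] \subset E) ||
  [exists e, true && [exists f, true && clique_common e f E]].
Proof.
apply: contraNT; rewrite negb_or negb_exists => /andP[/subsetPn[e0 _ e0E] /forallP H].
have := valP e0 => /cards2P[x0 [y0 [xy0 exy0]]].
apply: CFS_of_common_links.
  exists (x0, y0); rewrite /nonedge /= xy0 /=; apply: contra e0E => /adjP[e eE exy].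
  by rewrite (_ : e0 = e) //; apply: val_inj; rewrite exy exy0.
move=> [a c] [b d] /andP[/= ac nac] /andP[/= bd nbd].
have [e eac eE] := adj_edgeN ac nac; have [f fbd fE] := adj_edgeN bd nbd.
have := H e; rewrite negb_exists => /forallP/(_ f); rewrite /= negb_and.
have -> /= : [disjoint [set e; f] & E].
  by rewrite disjoint_subset; apply/subsetP => z; rewrite !inE => /orP[]/eqP->.
set X := val e :|: val f.
rewrite negb_forall => /existsP[x]; rewrite negb_imply => /andP[xC].
rewrite negb_forall => /existsP[y]; rewrite negb_imply => /andP[yC].
rewrite negb_imply => /andP[xy nxy].
have adjX w : w \in common E X -> forall v, v \in X -> adj (GE E) w v.
  rewrite !inE => /andP[wX]; rewrite cross_sub; last by rewrite disjoint_sym disjoints1 inE.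
  by move=> /forall_inP h v vX; rewrite adj_sym; apply: (forall_inP (h v vX)); rewrite inE.
have [aX bX cX dX] : [/\ a \in X, b \in X, c \in X & d \in X].
  by rewrite /X eac fbd !inE !eqxx ?orbT.
exists (x, y); apply/andP; split; apply/and5P; split; rewrite /nonedge ?[fst _]/= ?[snd _]/=.
all: by rewrite ?ac ?nac ?bd ?nbd ?xy ?nxy // ?(adj_sym _ a) ?(adj_sym _ c) !adjX.
Qed.

Lemma common_mix X E1 E2 : common (mix (~: inner (~: X)) E1 E2) X = common E1 X.
Proof.
apply/setP => w; rewrite !inE; case: (boolP (w \in X)) => //= wX.
rewrite mix_subl //; apply/subsetP => e /crossP[x [y [xX _ exy]]].
by rewrite !inE; apply/subsetPn; exists x; rewrite ?exy !inE ?eqxx ?xX.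
Qed.

(** [F] is the set of edges meeting [X]. It determines whether [e] and [f] are absent and what the
    common neighbourhood is; the edges inside that neighbourhood are still independent. Having at
    most [k] common neighbours is bounded separately. *)
Lemma Pr_clique_common e f k :
  Pr p (clique_common e f) <=
    2%:R ^+ k * (1 - p ^+ 4 / 2%:R) ^+ (n - 4)
    + (1 - p) ^+ #|[set e; f]| * p ^+ 'C(k, 2).
Proof.
set X := val e :|: val f; have /andP[p0 p1] := p01.
have cX : (#|X| <= 4)%N.
  by rewrite (leq_trans (leq_card_setU _ _)) // (eqP (valP e)) (eqP (valP f)).
have dX w : w \notin X -> [disjoint X & [set w]] by rewrite disjoint_sym disjoints1.
pose D := [set e; f]; pose F := ~: inner (~: X).
have DF : D \subset F.
  have notin (g : possible_edge n) : val g \subset X -> g \in F.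
    move=> gX; rewrite !inE; have := valP g => /cards2P[x [y [_ gxy]]].
    apply/subsetPn; exists x; first by rewrite gxy !inE eqxx.
    by rewrite inE negbK; apply: (subsetP gX); rewrite gxy !inE eqxx.
  by apply/subsetP => g /set2P[]->; apply: notin; rewrite ?subsetUl ?subsetUr.
apply: le_trans (_ : Pr p (fun E => (count (fun w => cross X [set w] \subset E) (enum (~: X)) <= k)%N
  || [&& [disjoint D & E], (k <= #|common E X|)%N & clique (GE E) (common E X)]) <= _).
  apply: (le_Pr p01) => E /andP[dE cl]; rewrite dE cl andbT /=.
  have -> : count (fun w => cross X [set w] \subset E) (enum (~: X)) = #|common E X|.
    rewrite -size_filter cardE /common; congr size; rewrite /(enum _) -filter_predI.
    by apply: eq_filter => w; rewrite !inE andbC.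
  by rewrite leq_total.
apply: le_trans (Pr_or p01 _ _) (lerD _ _).
  (* The choice [l] = 1/2 produces both the factor 2^k and the halved [p ^+ 4]. *)
  apply: le_trans (Pr_few_blocks p01 (B := fun w => cross X [set w]) (l := 2%:R^-1) (b := 4) k _ _ _ _) _.
  - by lra.
  - exact: enum_uniq.
  - move=> v w; rewrite !mem_enum => vX wX vw.
    apply: (@cross_disjoint _ X); rewrite ?sub1set //.
    by rewrite disjoints1 inE vw orbT.
  - by move=> w; rewrite mem_enum inE => wX; rewrite card_cross ?dX // cards1 muln1.
  have half : 1 - 2^-1 = 2^-1 :> R by field.
  rewrite invrK half -cardE [_ * p ^+ 4]mulrC; apply: ler_wpM2l; first by rewrite exprn_ge0 ?ler0n.
  have p41 : p ^+ 4 <= 1 by rewrite exprn_ile1.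
  have p40 : 0 <= p ^+ 4 by rewrite exprn_ge0.
  apply: ler_wiXn2l; [lra|lra|].
  by rewrite cardsCs setCK card_ord leq_sub2l.
rewrite [X in X <= _](Ex_mix p F) mulrC -Pr_disjoint -ExZ.
apply: (le_Ex p01) => E1; case: (boolP [disjoint D & E1]) => [dE|ndE]; last first.
  rewrite mulr0; under eq_Ex => E2 do rewrite mix_disjl // (negbTE ndE) /=.
  by rewrite Ex_cst.
rewrite mulr1; set C := common E1 X.
have [kC|kC] := leqP k #|C|; last first.
  under eq_Ex => E2 do rewrite common_mix -/C leqNgt kC andbF /=.
  by rewrite Ex_cst exprn_ge0.
apply: le_trans (_ : Pr p (fun E2 => inner C \subset E2) <= _); last first.
  rewrite Pr_sub card_inner ler_wiXn2l //; exact: leq_bin2l.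
apply: (le_Pr p01) => E2; rewrite common_mix -/C => /and3P[_ _].
rewrite -inner_sub mix_subr // disjoint_subset; apply/subsetP => g.
rewrite !inE negbK => gC; apply: subset_trans gC _.
by apply/subsetP => w; rewrite inE => /andP[].
Qed.

Lemma Pr_CFSN_common k :
  Pr p (fun E => ~~ CFS (GE E)) <=
    p ^+ 'C(n, 2) + n%:R ^+ 4 * (2%:R ^+ k * (1 - p ^+ 4 / 2%:R) ^+ (n - 4))
    + (n%:R ^+ 2 * (1 - p) + (n%:R ^+ 2 * (1 - p)) ^+ 2) * p ^+ 'C(k, 2).
Proof.
have /andP[p0 p1] := p01; have q0 : 0 <= 1 - p by rewrite subr_ge0.
have cE : #|possible_edge n| = 'C(n, 2).
  by have := card_draws 'I_n 2; rewrite card_ord => <-; rewrite card_sig cardsE; apply: eq_card.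
have cE2 : (#|possible_edge n|)%:R <= n%:R ^+ 2 :> R.
  by rewrite cE -natrX ler_nat (leq_trans (leq_pmulr _ (fact_gt0 2))) // bin_ffact ffactnSr ffactn1 leq_mul // leq_subr.
apply: le_trans (le_Pr p01 CFSN_clique_common) _.
rewrite -addrA; apply: le_trans (Pr_or p01 _ _) (lerD _ _).
  by rewrite Pr_sub cardsT cE.
apply: le_trans (Pr_exists p01 _ (fun e E => [exists f, true && clique_common e f E])) _.
set a := 2%:R ^+ k * _; set b := p ^+ 'C(k, 2).
have p40 : 0 <= p ^+ 4 <= 1 by rewrite exprn_ge0 ?exprn_ile1.
have a0 : 0 <= a by rewrite /a mulr_ge0 ?exprn_ge0 ?ler0n //; lra.
have b0 : 0 <= b by rewrite exprn_ge0.
set N := #|possible_edge n| in cE2.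
have row e : Pr p (fun E => [exists f, true && clique_common e f E])
    <= N%:R * a + ((1 - p) + N%:R * (1 - p) ^+ 2) * b.
  apply: le_trans (Pr_exists p01 _ (fun f E => clique_common e f E)) _.
  apply: le_trans (ler_sum _ (fun f _ => Pr_clique_common e f k)) _.
  rewrite big_split /= sumr_const -[X in X + _]mulr_natl lerD2l -mulr_suml ler_wpM2r //.
  (* The term [f] = [e] requires one absent edge, the others two. *)
  rewrite (bigD1 e) //= setUid cards1 expr1 lerD2l.
  rewrite mulr_natl -sumr_const big_mkcond; apply: ler_sum => f _.
  by case: eqVneq => [_|fe]; rewrite ?exprn_ge0 // cards2 eq_sym fe.
apply: le_trans (ler_sum _ (fun e _ => row e)) _.
have N0 : 0 <= N%:R :> R by rewrite ler0n.
have NN : N%:R ^+ 2 <= n%:R ^+ 4 :> R by rewrite -[4%N]/(2 * 2)%N exprM lerXn2r ?nnegrE ?exprn_ge0.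
rewrite sumr_const -[X in X <= _]mulr_natl -/N mulrDr mulrA -expr2; apply: lerD.
  exact: ler_wpM2r.
rewrite mulrA; apply: ler_wpM2r => //; rewrite mulrDr mulrA -expr2 exprMn -exprM.
by apply: lerD; apply: ler_wpM2r; rewrite ?exprn_ge0.
Qed.

End CommonLinks.

(** * Asymptotics *)

From mathcomp Require Import all_classical all_reals all_analysis.
Import numFieldNormedType.Exports.
Local Open Scope classical_set_scope.
Local Open Scope ring_scope.

Section Asymptotics.
Variable R : realType.

Lemma exprB_le_expR (a : R) m : 0 <= a <= 1 -> (1 - a) ^+ m <= expR (- (m%:R * a)).
Proof.
move=> /andP[a0 a1]; rewrite -mulrN expRM_natl lerXn2r ?nnegrE ?expR_ge0 ?subr_ge0 //.
exact: expR_ge1Dx.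
Qed.

(** Keeps a single term of the exponential series of [z]. *)
Lemma expRN_le_fact (z : R) m : 0 < z -> expR (- z) <= m.+1`!%:R / z ^+ m.+1.
Proof.
move=> z0; rewrite expRN -[X in _ <= X]invf_div lef_pV2 ?posrE ?expR_gt0 //; last first.
  by rewrite divr_gt0 ?exprn_gt0 // ltr0n fact_gt0.
by apply: le_trans (expR_ge1Dxn m (ltW z0)); rewrite lerDr ler01.
Qed.

Lemma expRN_le_invX (n k : nat) (z : R) : (0 < n)%N -> k%:R * ln n%:R <= z ->
  expR (- z) <= n%:R^-1 ^+ k.
Proof.
move=> n0 kz; apply: le_trans (_ : expR (- (k%:R * ln n%:R)) <= _).
  by rewrite ler_expR lerN2.
by rewrite -mulrN expRM_natl expRN lnK // posrE ltr0n.
Qed.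

Lemma divn8_bounds n : (72 <= n)%N ->
  [/\ n <= 9 * (n %/ 8), 8 * (n %/ 8) <= n, 8 <= n %/ 8 & 0 < n]%N.
Proof. by move=> n72; split; lia. Qed.

Lemma sparse_bound (n : nat) (p : R) :
    0 < p < 1 -> (72 <= n)%N -> 4 ^+ 17 <= n%:R :> R -> expR 1 <= n%:R :> R ->
    5 * Num.sqrt (ln n%:R / n%:R) <= p -> n%:R * p ^+ 8 <= 1 ->
  Pr p (fun E => ~~ CFS (@graph_of_edges n E)) <= (5 + 2 * 4 ^+ 17) / n%:R.
Proof.
(* [K] is [l^-1 ^+ t] for the choices [l] = 1/4 and [t] = 17. *)
have [K EK] : exists K : R, K = 4 ^+ 17 by exists (4 ^+ 17).
rewrite -EK => /andP[p0 p1] n72 n4 ne pl np8.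
have [h9n h8n h8 n0'] := divn8_bounds n72.
have n0 : 0 < n%:R :> R by rewrite ltr0n.
have [p0' p1' p01] : [/\ 0 <= p, p <= 1 & 0 <= p <= 1] by rewrite !ltW.
set h := (n %/ 8)%N in h9n h8n h8; set N : R := n%:R in n4 ne pl np8 n0 *.
have Ni0 : 0 < N^-1 by rewrite invr_gt0.
have [N0' Ni0'] : 0 <= N /\ 0 <= N^-1 by rewrite !ltW.
have L1 : 1 <= ln N by rewrite -(expRK 1) ler_ln ?posrE ?expR_gt0.
have h9 : N <= 9 * h%:R.
  by rewrite /N -natrM ler_nat.
have p2 : 25 * ln N <= p ^+ 2 * N.
  have s0 : 0 <= ln N / N by rewrite divr_ge0 //; lra.
  have : (5 * Num.sqrt (ln N / N)) ^+ 2 <= p ^+ 2.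
    by apply: lerXn2r => //; rewrite nnegrE ?mulr_ge0 ?sqrtr_ge0.
  rewrite exprMn sqr_sqrtr // mulrA ler_pdivrMr //; lra.
have y2 : 25 * ln N <= 9 * (h%:R * p ^+ 2).
  have -> : 9 * (h%:R * p ^+ 2) = p ^+ 2 * (9 * h%:R) by ring.
  by apply: le_trans p2 _; apply: ler_wpM2l => //; rewrite exprn_ge0.
have pk k : 0 <= p ^+ k <= 1 by rewrite exprn_ge0 ?exprn_ile1.
have p8 : p ^+ 8 <= N^-1 by rewrite -[N^-1]mul1r ler_pdivlMr // mulrC.
(* The exponent is (3/2) h p^2 >= (25/6) ln N by [y2], just above 4 ln N; the constant 5 of the
   lower bound on [p] enters here as 25. *)
have Hr : (1 - (1 - 4^-1) * p ^+ 2) ^+ (2 * h) <= N^-1 ^+ 4.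
  apply: le_trans (exprB_le_expR _ _) _; first by have /andP[? ?] := pk 2%N; lra.
  apply: expRN_le_invX; first exact: n0'.
  by rewrite natrM; lra.
have H1 : (1 - p ^+ 2) ^+ h <= N^-1 ^+ 2.
  apply: le_trans (exprB_le_expR _ (pk 2%N)) _.
  by apply: expRN_le_invX; [exact: n0'|lra].
have H2 : (1 - p ^+ 4) ^+ (h * h) <= N^-1 ^+ 1.
  apply: le_trans (exprB_le_expR _ (pk 4%N)) _.
  apply: expRN_le_invX; first exact: n0'.
  have -> : (h * h)%:R * p ^+ 4 = (h%:R * p ^+ 2) ^+ 2 by rewrite natrM; ring.
  (* The square of (25/9) ln N exceeds ln N because ln N >= 1. *)
  nra.
have H3 : p ^+ (2 * h) <= N^-1 ^+ 2.
  apply: le_trans (_ : (p ^+ 8) ^+ 2 <= _).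
    by rewrite -exprM ler_wiXn2l // (leq_mul2l 2 8 h).
  by apply: lerXn2r => //; rewrite nnegrE exprn_ge0.
have H4 : N ^+ 18 * p ^+ 'C(18, 2) <= N^-1.
  (* Cliques on 18 vertices have 153 = 8 * 18 + 9 edges, so one factor [p ^+ 8 <= N^-1] is left
     over. *)
  have -> : N ^+ 18 * p ^+ 'C(18, 2) = (N * p ^+ 8) ^+ 18 * p * p ^+ 8.
    by rewrite (_ : 'C(18, 2) = 153%N) //; ring.
  apply: le_trans p8; rewrite ler_piMl ?exprn_ge0 //.
  by rewrite mulr_ile1 ?exprn_ile1 ?exprn_ge0 ?mulr_ge0 ?exprn_ge0.
have NV : N * N^-1 = 1 by rewrite divff // gt_eqF.
have r1 : N ^+ 2 * (4^-1^-1 ^+ 17 * (1 - (1 - 4^-1) * p ^+ 2) ^+ (2 * h)) <= K * N^-1 ^+ 2.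
  rewrite invrK -EK mulrCA; apply: ler_wpM2l; first by rewrite EK exprn_ge0.
  apply: le_trans (ler_wpM2l _ Hr) _; first by rewrite exprn_ge0.
  have -> : N ^+ 2 * N^-1 ^+ 4 = (N * N^-1) ^+ 2 * N^-1 ^+ 2 by ring.
  by rewrite NV expr1n mul1r.
have r2 : K * N^-1 ^+ 2 <= 1.
  apply: le_trans (_ : N * N^-1 ^+ 2 <= _); first by rewrite ler_wpM2r ?exprn_ge0.
  have -> : N * N^-1 ^+ 2 = N * N^-1 * N^-1 by ring.
  rewrite NV mul1r invf_le1 //; apply: le_trans ne; apply: le_trans (expR_ge1Dx 1); lra.
apply: le_trans (@Pr_CFSN_sparse _ n p p01 17 h 4^-1 _ _ _ _) _.
- by lra.
- exact: h8n.
- by apply: leq_trans (leq_mul (leqnn 4) h8).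
- exact: le_trans r1 r2.
have E1 : N * (K * N^-1 ^+ 2) = K * N^-1.
  have -> : N * (K * N^-1 ^+ 2) = K * (N * N^-1) * N^-1 by ring.
  by rewrite NV mulr1.
have E2 : N * (N^-1 ^+ 2 + N^-1 ^+ 2) = 2 * N^-1.
  have -> : N * (N^-1 ^+ 2 + N^-1 ^+ 2) = 2 * (N * N^-1) * N^-1 by ring.
  by rewrite NV mulr1.
apply: le_trans (_ : 2 * (N^-1 + K * N^-1) + (2 * N^-1 + N^-1) <= _); last first.
  by rewrite le_eqVlt; apply/orP; left; apply/eqP; ring.
rewrite -E1 -E2 -/N; apply: lerD.
  by apply: ler_wpM2l => //; apply: lerD => //; apply: ler_wpM2l r1; exact: ltW.
apply: lerD; last by rewrite -[X in _ <= X]expr1.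
by apply: ler_wpM2l; [exact: ltW|exact: lerD].
Qed.

Lemma expRN_le_invX_cst m :
  exists2 C : R, 0 < C & forall z, 0 < z -> expR (- z) <= C / z ^+ m.+1.
Proof. by exists m.+1`!%:R => [|z z0]; [rewrite ltr0n fact_gt0|exact: expRN_le_fact]. Qed.

Lemma sqr_le_bin2 n : (2 <= n)%N -> n%:R ^+ 2 <= 4 * 'C(n, 2)%:R :> R.
Proof.
move=> n2; rewrite -natrX -natrM ler_nat.
have := bin_ffact n 2; rewrite ffactnSr ffactn1 (_ : 2`! = 2)%N //; nia.
Qed.

Lemma exprn_bin2_le (p : R) n : 0 <= p <= 1 -> (2 <= n)%N ->
  p ^+ 'C(n, 2) <= expR (- ((1 - p) * n%:R ^+ 2 / 4)).
Proof.
move=> /andP[p0 p1] n2.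
have -> : p ^+ 'C(n, 2) = (1 - (1 - p)) ^+ 'C(n, 2) by congr (_ ^+ _); ring.
apply: le_trans (exprB_le_expR _ _) _; first by rewrite subr_ge0 p1 lerBlDr lerDl.
have := sqr_le_bin2 n2; set c := 'C(n, 2)%:R; set s := _ ^+ 2 => sc.
by rewrite ler_expR lerN2; nra.
Qed.

Lemma dense_bound : exists C D : R, forall (n : nat) (p : R),
    0 < p < 1 -> (1024 <= n)%N -> 1 <= n%:R * p ^+ 8 -> 1 <= (1 - p) * n%:R ^+ 2 ->
  Pr p (fun E => ~~ CFS (@graph_of_edges n E)) <= C / n%:R + D / ((1 - p) * n%:R ^+ 2).
Proof.
(* The powers are 10, 5, 3 and 1: y^10 is at least of order n^5, against n^4; n^5 is used against
   x^2 <= n^4; x^3 against x^2; and x alone for the complete graph. *)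
have [A10 A10p HA10] := expRN_le_invX_cst 9.
have [A5 A5p HA5] := expRN_le_invX_cst 4.
have [A3 A3p HA3] := expRN_le_invX_cst 2.
have [A1 A1p HA1] := expRN_le_invX_cst 0.
exists (expR 2 * A10 * 16 ^+ 5 + 2 * A5 * 512 ^+ 5), (A1 * 4 + 2 * A3 * (2 ^+ 16) ^+ 3).
move=> n p /andP[p0 p1] n1024 np8; set x := (1 - p) * _ => x1.
have n2 : (2 <= n)%N by apply: leq_trans n1024.
have n4 : (4 <= n)%N by apply: leq_trans n1024.
have n1 : (0 < n)%N by apply: leq_trans n1024.
have [p0' p1' p01] : [/\ 0 <= p, p <= 1 & 0 <= p <= 1] by rewrite !ltW.
have N1024 : 1024 <= n%:R :> R by rewrite ler_nat.
have N0 : 0 < n%:R :> R by rewrite ltr0n.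
have x0 : 0 < x by apply: lt_le_trans x1.
have q0 : 0 <= 1 - p by rewrite subr_ge0.
(* [y] is half the threshold exponent: the bound on few common neighbours is about 2^y exp(-2y), and
   n p^8 >= 1 gives y^2 >= n/16. The cutoff [k] is the integer part of [y]. *)
pose y : R := n%:R * p ^+ 4 / 4.
have p40 : 0 < p ^+ 4 by rewrite exprn_gt0.
have p41 : p ^+ 4 <= 1 by rewrite exprn_ile1.
have y0 : 0 < y by rewrite /y divr_gt0 ?mulr_gt0.
have y2 : n%:R / 16 <= y ^+ 2.
  have -> : y ^+ 2 = n%:R / 16 * (n%:R * p ^+ 8) by rewrite /y; field.
  by rewrite ler_peMr // divr_ge0 ?ler0n.
have y8 : 8 <= y.
  rewrite -(@ler_pXn2r _ 2) ?nnegrE ?(ltW y0) //; apply: le_trans y2; lra.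
have /andP[k1 k2] := truncn_itv (ltW y0); set k := Num.truncn y in k1 k2.
have k2' : y < k%:R + 1 by rewrite -natr1 in k2.
have k2n : (2 <= k)%N by rewrite -(ler_nat R); lra.
apply: le_trans (Pr_CFSN_common _ p01 k) _.
have Hy : expR (- y) <= A10 * (16 / n%:R) ^+ 5.
  apply: le_trans (HA10 _ y0) _; rewrite ler_wpM2l ?(ltW A10p) //.
  have -> : (16 / n%:R) ^+ 5 = ((n%:R / 16) ^+ 5)^-1 :> R by rewrite -exprVn invf_div.
  rewrite lef_pV2 ?posrE ?exprn_gt0 // ?divr_gt0 //.
  rewrite (_ : y ^+ 10 = (y ^+ 2) ^+ 5); last by rewrite -exprM.
  by apply: lerXn2r => //; rewrite nnegrE; [rewrite divr_ge0 ?ler0n|rewrite exprn_ge0 // ltW].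
have T0 : p ^+ 'C(n, 2) <= A1 * 4 / x.
  apply: le_trans (exprn_bin2_le p01 n2) _; rewrite -/x.
  have x4 : 0 < x / 4 by rewrite divr_gt0.
  by apply: le_trans (HA1 _ x4) _; rewrite expr1 invf_div mulrA.
have T1 : n%:R ^+ 4 * (2 ^+ k * (1 - p ^+ 4 / 2) ^+ (n - 4)) <= expR 2 * A10 * 16 ^+ 5 / n%:R.
  have h2 : 2 ^+ k <= expR y.
    apply: le_trans (_ : expR 1 ^+ k <= _).
      apply: lerXn2r; rewrite ?nnegrE ?expR_ge0 //.
      by apply: le_trans (expR_ge1Dx 1); lra.
    by rewrite -expRM_natl mulr1 ler_expR.
  have h3 : (1 - p ^+ 4 / 2) ^+ (n - 4) <= expR (2 - 2 * y).
    apply: le_trans (exprB_le_expR _ _) _; first lra.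
    by rewrite ler_expR natrB // /y; lra.
  apply: le_trans (_ : n%:R ^+ 4 * (expR y * expR (2 - 2 * y)) <= _).
    apply: ler_wpM2l; first by rewrite exprn_ge0.
    by apply: ler_pM => //; apply: exprn_ge0; lra.
  have -> : expR y * expR (2 - 2 * y) = expR 2 * expR (- y) by rewrite -!expRD; congr expR; ring.
  apply: le_trans (_ : n%:R ^+ 4 * (expR 2 * (A10 * (16 / n%:R) ^+ 5)) <= _).
    apply: ler_wpM2l; first by rewrite exprn_ge0.
    by apply: ler_wpM2l; [exact: expR_ge0|exact: Hy].
  rewrite le_eqVlt; apply/orP; left; apply/eqP; field.
  by rewrite gt_eqF.
have T2 : (x + x ^+ 2) * p ^+ 'C(k, 2) <= 2 * A5 * 512 ^+ 5 / n%:R + 2 * A3 * (2 ^+ 16) ^+ 3 / x.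
  have e0 : 0 <= p ^+ 'C(k, 2) by rewrite exprn_ge0.
  have P1 : 0 <= 2 * A5 * 512 ^+ 5 / n%:R.
    by rewrite !mulr_ge0 ?invr_ge0 ?ler0n ?exprn_ge0 // ltW.
  have P2 : 0 <= 2 * A3 * (2 ^+ 16) ^+ 3 / x.
    by rewrite !mulr_ge0 ?invr_ge0 ?ler0n ?exprn_ge0 // ltW.
  (* Since y >= 8 and k > y - 1, k is at least y/2. *)
  have hk : p ^+ 'C(k, 2) <= expR (- ((1 - p) * y ^+ 2 / 16)).
    apply: le_trans (exprn_bin2_le p01 k2n) _; rewrite ler_expR lerN2.
    have : (y / 2) ^+ 2 <= k%:R ^+ 2 by apply: lerXn2r; rewrite ?nnegrE ?ler0n //; lra.
    by set s := k%:R ^+ 2 => ys; nra.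
  have x2 : x + x ^+ 2 <= 2 * x ^+ 2 by nra.
  have x2p : 0 < x ^+ 2 by rewrite exprn_gt0.
  apply: le_trans (ler_pM _ _ x2 hk) _ => //; first by rewrite addr_ge0 ?ltW.
  (* The exponent (1 - p) y^2 / 16 equals x p^8 / 256, at least x / 2^16 when p >= 1/2. When p < 1/2
     it is at least n/512, because 1 - p > 1/2 and y^2 >= n/16. *)
  have [ph|ph] := lerP (1 / 2) p.
    rewrite -[X in X <= _]add0r; apply: lerD => //.
    have z0 : 0 < x / 2 ^+ 16 by rewrite divr_gt0 ?exprn_gt0.
    apply: le_trans (_ : 2 * x ^+ 2 * (A3 / (x / 2 ^+ 16) ^+ 3) <= _).
      apply: ler_wpM2l; first by rewrite mulr_ge0 // ltW.
      apply: le_trans (HA3 _ z0); rewrite ler_expR lerN2.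
      have p8 : (1 / 2) ^+ 8 <= p ^+ 8 by apply: lerXn2r; rewrite ?nnegrE //; lra.
      have -> : (1 - p) * y ^+ 2 / 16 = x * p ^+ 8 / 256 by rewrite /x /y; field.
      by move: p8; set u := p ^+ 8 => p8; nra.
    by rewrite le_eqVlt; apply/orP; left; apply/eqP; field; rewrite gt_eqF.
  rewrite -[X in X <= _]addr0; apply: lerD => //.
  have z0 : 0 < n%:R / 512 :> R by rewrite divr_gt0 ?ltr0n.
  have xn : x ^+ 2 <= n%:R ^+ 4.
    have -> : n%:R ^+ 4 = (n%:R ^+ 2) ^+ 2 :> R by rewrite -exprM.
    apply: lerXn2r; rewrite ?nnegrE ?exprn_ge0 ?(ltW x0) //.
    by rewrite /x ler_piMl ?exprn_ge0 //; lra.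
  apply: le_trans (_ : 2 * n%:R ^+ 4 * (A5 / (n%:R / 512) ^+ 5) <= _).
    apply: ler_pM; rewrite ?expR_ge0 ?mulr_ge0 ?(ltW x2p) //.
      by rewrite ler_pM2l.
    apply: le_trans (HA5 _ z0); rewrite ler_expR lerN2; nra.
  by rewrite le_eqVlt; apply/orP; left; apply/eqP; field; rewrite gt_eqF.
rewrite !mulrDl; move: T0 T1 T2; rewrite [n%:R ^+ 2 * _]mulrC -/x; lra.
Qed.

End Asymptotics.

(** * Passage to the limit, combining the sparse and dense bounds *)

Unset Implicit Arguments.

Theorem theorem4p1 (R : realType) (p : nat -> R)
    (p01 : forall n, 0 < p n < 1)
    (p_upper : (1 - p n) * n%:R ^+ 2 @[n --> \oo] --> +oo)
    (p_lower : \forall n \near \oo, 5 * Num.sqrt (ln n%:R / n%:R) <= p n) :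
  Gnp_prob (p n) (@CFS 'I_n) @[n --> \oo] --> (1 : R).
Proof.
have [C [D HD]] := dense_bound R.
pose P n : R := Pr (p n) (fun E => ~~ CFS (@graph_of_edges n E)).
have GP : (fun n => Gnp_prob (p n) (@CFS 'I_n)) = (fun n => 1 - P n).
  by apply/funext => n; rewrite /P -Pr_compl PrE.
pose x n : R := (1 - p n) * n%:R ^+ 2.
have x_gt0 : \forall n \near \oo, 0 < x n by apply: (cvgry_gt p_upper).
have x_ge1 : \forall n \near \oo, 1 <= x n by apply: (cvgry_ge p_upper).
have n_gt0 : \forall n \near \oo, 0 < n%:R :> R by apply: (cvgry_gt (@cvgr_idn R)).
have big (c : R) : \forall n \near \oo, c <= n%:R by apply: (cvgry_ge (@cvgr_idn R)).
(* One bound valid in both cases, which may alternate with [n]; absolute values are taken because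
   the signs of [C] and [D] are not known. *)
pose b n := (5 + 2 * 4 ^+ 17 + `|C|) * n%:R^-1 + `|D| * (x n)^-1.
have b0 : b n @[n --> \oo] --> (0 : R).
  rewrite -[0 : R](_ : (5 + 2 * 4 ^+ 17 + `|C|) * 0 + `|D| * 0 = 0); last by rewrite !mulr0 addr0.
  apply: cvgD; apply: cvgMr.
    by apply/(gtr0_cvgV0 n_gt0); exact: cvgr_idn.
  by apply/(gtr0_cvgV0 x_gt0); exact: p_upper.
have Pb : \forall n \near \oo, 0 <= P n <= b n.
  near=> n.
  have n_pos : 0 < n%:R :> R by near: n.
  have xp : 0 < x n by near: n.
  have /andP[p0 p1] := p01 n.
  have pp : 0 <= p n <= 1 by rewrite !ltW.
  have nD : 0 <= `|D| * (x n)^-1 by rewrite mulr_ge0 // invr_ge0 ltW.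
  have ni : 0 <= n%:R^-1 :> R by rewrite invr_ge0 ltW.
  rewrite Pr_ge0 //=; have [h8|h8] := lerP (n%:R * p n ^+ 8) 1.
    have S : P n <= (5 + 2 * 4 ^+ 17) / n%:R.
      apply: sparse_bound => //; last by near: n.
      - by rewrite -(ler_nat R); near: n; exact: big.
      - by near: n; exact: big.
      - by near: n; exact: big.
    apply: le_trans S _; rewrite /b [X in _ <= X + _]mulrDl -[X in _ <= X]addrA lerDl.
    by rewrite addr_ge0 // mulr_ge0.
  have S : P n <= C / n%:R + D / x n.
    apply: HD => //; [|exact: ltW|by near: n].
    by rewrite -(ler_nat R); near: n; exact: big.
  apply: le_trans S _; apply: lerD; apply: ler_wpM2r; rewrite ?invr_ge0 ?(ltW xp) //.
    by rewrite (le_trans (ler_norm C)) // lerDr addr_ge0 // mulr_ge0 // exprn_ge0.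
  exact: ler_norm.
have P0 : P n @[n --> \oo] --> (0 : R).
  by apply: (squeeze_cvgr Pb) => //; exact: cvg_cst.
rewrite GP -[X in _ --> X]subr0.
by apply: cvgB => //; exact: cvg_cst.
Unshelve. all: by end_near.
Qed.
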